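(* Let $k\ge1$ and $g\ge0$ be integers. The mapping $\Psi_{g,k}:\mathbf Q_{g,k}\to\mathbf{LM}_{g,k}$ is two-to-one (every element of $\mathbf{LM}_{g,k}$ has exactly two preimages).
   Context: Maps. A map of genus $g$ is a finite connected graph (loops and multiple edges allowed, non-empty edge set) embedded in the compact connected oriented surface without boundary of genus $g$ such that all faces are simply connected, considered up to orientation-preserving homeomorphisms (which must preserve any additional marked structure). $V,\mathbf E,E,F$ denote the sets of vertices, unoriented edges, half-edges (oriented edges) and faces. A half-edge $e$ has origin $e^-$, target $e^+$ and reversal $\bar e$. A map is rooted if a half-edge $e_*$ is distinguished. A half-edge is incident to the face on its left; $e\in f$ means $e$ is incident to $f$. $\sigma$ is the permutation of $E$ listing cyclically, in counterclockwise order, the half-edges going out of each vertex; $\alpha(e)=\bar e$; $\varphi=\sigma^{-1}\alpha^{-1}$, whose cycles list the half-edges incident to each face in counterclockwise order. The corner incident to $e$ is the angular sector at $e^-$ between $e$ and $\sigma(e)$ (it lies in the face to the left of $e$); corners are identified with half-edges. $d_{\mathbf q}$ is the graph distance. A quadrangulation is a map whose faces all have degree 4; bipartite means properly vertex 2-colorable. The set $\mathbf Q_{g,k}$: triples $(\mathbf q,\mathbf x,D)$ where $\mathbf q$ is a rooted bipartite quadrangulation of genus $g$, $\mathbf x=(x_1,\dots,x_k)\in V(\mathbf q)^k$, and $D=[d_1,\dots,d_k]$ is an element of $\mathbb Z^k$ modulo addition of a common integer (a delay vector) with $|d_i-d_j|<d_{\mathbf q}(x_i,x_j)$ for all $i\ne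 j$ and $d_{\mathbf q}(x_i,x_j)+d_i-d_j$ an even non-negative integer for all $i,j$ (for $k=1$, $D=[0]$). $\mathbf Q^\circ_{g,k}$ is the analogous set with $\mathbf q$ unrooted. The set $\mathbf{LM}_{g,k}$: pairs $(\mathbf m,[\mathbf l])$ where $\mathbf m$ is a rooted map of genus $g$ with $k$ faces indexed $f_1(\mathbf m),\dots,f_k(\mathbf m)$, and $[\mathbf l]$ is the class, modulo an additive constant in $\mathbb Z$, of a labeling $\mathbf l:V(\mathbf m)\to\mathbb Z$ with $|\mathbf l(x)-\mathbf l(y)|\le1$ for adjacent $x,y$. $\mathbf{LM}^\circ_{g,k}$ is the analogous set with $\mathbf m$ unrooted. For a half-edge $e$, $\mathbf l(e):=\mathbf l(e^-)$. The map $\Psi^\circ_{g,k}:\mathbf Q^\circ_{g,k}\to\mathbf{LM}^\circ_{g,k}$: choose a representative $(d_1,\dots,d_k)$ of $D$ and label $V(\mathbf q)$ by $\mathbf l(x)=\min_i(d_i+d_{\mathbf q}(x,x_i))$; adjacent vertices have labels differing by exactly 1. Reading the labels counterclockwise around a face from a vertex of lowest label one finds either $l,l+1,l+2,l+1$ (simple face) or $l,l+1,l,l+1$ (confluent face). In each simple face add an edge linking the vertex (corner) of highest label to its successor in clockwise order around the face (splitting it into a face of degree 4 and a face of degree 2); in each confluent face add an edge linking the two vertices (corners) of highest label. The added edges alone form a map $\mathbf m$ with vertex set $V(\mathbf q)\setminus\{x_1,\dots,x_k\}$, each of whose faces contains exactly one $x_i$, and is indexed as $f_i(\mathbf m)$;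 $\Psi^\circ_{g,k}(\mathbf q,\mathbf x,D)=(\mathbf m,[\mathbf l|_{V(\mathbf m)}])$. Conversely, $\mathbf q$ is recovered from $(\mathbf m,[\mathbf l])$ as follows: set $\mathbf l(x_i)=\min_{e\in f_i(\mathbf m)}\mathbf l(e)-1$; define the successor of $e\in f_i(\mathbf m)$ as $s(e)=x_i$ if $\mathbf l(e)=\mathbf l(x_i)+1$ and otherwise $s(e)=\varphi^{m(e)}(e)$, $m(e)=\min\{m\ge1:\mathbf l(\varphi^m(e))=\mathbf l(e)-1\}$; the edges of $\mathbf q$ are exactly the edges drawn (without crossings, inside the faces) from the corner incident to $e$ to $s(e)$, one for each half-edge $e$ of $\mathbf m$. The map $\Psi_{g,k}$: let $(\mathbf q,\mathbf x,D)\in\mathbf Q_{g,k}$ with root $e_*$, let $\mathbf q^\circ$ be the unrooted version of $\mathbf q$ and $(\mathbf m^\circ,[\mathbf l])=\Psi^\circ_{g,k}(\mathbf q^\circ,\mathbf x,D)$. There is a unique half-edge (corner) $e$ of $\mathbf m^\circ$ such that the edge drawn from $e$ to $s(e)$, oriented from $e$ to $s(e)$, is equal to $e_*$ or to its reversal. Root $\mathbf m^\circ$ at this $e$ to obtain $\mathbf m$, and set $\Psi_{g,k}(\mathbf q,\mathbf x,D)=(\mathbf m,[\mathbf l])$. *)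

(* Defs.v *)
From mathcomp Require Import all_boot all_order all_algebra.
Set Implicit Arguments.
Unset Strict Implicit.
Unset Printing Implicit Defensive.
Import Order.TTheory GRing.Theory Num.Theory.
Local Open Scope ring_scope.

(* A map is encoded by the finite set of its half-edges together with [sigma]
   (next half-edge counterclockwise around the origin) and [alpha] (reversal).
   Vertices, edges and faces are the orbits of [sigma], [alpha] and [phi],
   represented as sets of half-edges.  Homeomorphism classes of maps correspond
   to such data up to relabelling of the half-edges. *)

Record premap : Type := Premap {
  half :> finType;
  sigma : half -> half;
  alpha : half -> half }.

Arguments sigma {p} _.
Arguments alpha {p} _.

Section Maps.
Variable m : premap.
Implicit Types (e : m) (u v : {set m}).

Definition phi e : m := finv sigma (finv alpha e).

Definition orbit_set (f : m -> m) e : {set m} := [set e' | fconnect f e e'].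

Definition origin e : {set m} := orbit_set sigma e.
Definition target e : {set m} := origin (alpha e).

Definition vertices : {set {set m}} := [set origin e | e : m].
Definition edges : {set {set m}} := [set orbit_set alpha e | e : m].
Definition faces : {set {set m}} := [set orbit_set phi e | e : m].

(* Euler's relation #V - #E + #F = 2 - 2g, without subtraction in [nat]. *)
Definition map_of_genus (g : nat) : Prop :=
  [/\ injective (@sigma m),
      involutive (@alpha m) /\ (forall e, alpha e != e),
      (0 < #|m|)%N,
      forall e e', connect (fun a b => (sigma a == b) || (alpha a == b)) e e'
    & (#|vertices| + #|faces| + g.*2 = #|edges| + 2)%N].

Definition quadrangulation : Prop := forall f, f \in faces -> #|f| = 4%N.

Definition bipartite : Prop :=
  exists c : {set m} -> bool, forall e, c (origin e) != c (target e).

Definition adjacent : rel {set m} :=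
  fun u v => [exists e, (origin e == u) && (target e == v)].

(* Between two vertices of a connected map, a shortest walk has length less
   than the number of half-edges, so the bounded search always succeeds. *)
Definition dist u v : nat :=
  find (fun n => [exists p : n.-tuple {set m},
                    path adjacent u p && (last u p == v)])
       (iota 0 #|m|).

End Maps.

Definition map_iso (m m' : premap) (h : m -> m') : Prop :=
  [/\ bijective h,
      forall e, h (sigma e) = sigma (h e)
    & forall e, h (alpha e) = alpha (h e)].

(* The least [n >= 1] such that [P] holds at the [n]-th iterate of [f] on [x],
   when there is one and [f] is injective. *)
Definition first_hit (T : finType) (f : T -> T) (P : pred T) (x : T) : nat :=
  (find P (traject f (f x) #|T|)).+1.

Definition min_int (s : seq int) : int :=
  \big[Order.min/head 0 s]_(z <- s) z.

(* [qdelay] is a representative of the delay vector; the quotient by the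
   addition of a common integer is taken in [iso_unrootedQ]. *)
Record unrootedQ (k : nat) : Type := UnrootedQ {
  qmap : premap;
  qsource : 'I_k -> {set qmap};
  qdelay : 'I_k -> int }.

Record rootedQ (k : nat) : Type := RootedQ {
  qunroot :> unrootedQ k;
  qroot : qmap qunroot }.

(* Membership in Q°_{g,k}; since the root is an arbitrary half-edge, a
   [rootedQ] is in Q_{g,k} iff its unrooted version is in Q°_{g,k}. *)
Definition in_Q (g k : nat) (t : unrootedQ k) : Prop :=
  let x := @qsource k t in
  let d := @qdelay k t in
  [/\ map_of_genus (qmap t) g /\ quadrangulation (qmap t),
      bipartite (qmap t),
      forall i, x i \in vertices (qmap t),
      forall i j, i != j -> `|d i - d j| < (dist (x i) (x j))%:Z
    & forall i j, 0 <= (dist (x i) (x j))%:Z + d i - d j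
                  /\ (2 %| (dist (x i) (x j))%:Z + d i - d j)%Z].

Definition iso_unrootedQ (k : nat) (t t' : unrootedQ k)
    (h : qmap t -> qmap t') : Prop :=
  [/\ map_iso h,
      forall i, h @: qsource t i = qsource t' i
    & exists c : int, forall i, qdelay t' i = qdelay t i + c].

Definition isoQ (k : nat) (t t' : rootedQ k) : Prop :=
  exists2 h : qmap t -> qmap t', iso_unrootedQ h & h (qroot t) = qroot t'.

(* A labeling of the vertices is encoded as a function on half-edges,
   [llabel e] being the label of the origin of [e]; again only a representative
   modulo constants is stored. *)
Record unrootedLM (k : nat) : Type := UnrootedLM {
  lmap : premap;
  lface : 'I_k -> {set lmap};
  llabel : lmap -> int }.

Record rootedLM (k : nat) : Type := RootedLM {
  lunroot :> unrootedLM k;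
  lroot : lmap lunroot }.

Definition in_LM (g k : nat) (u : unrootedLM k) : Prop :=
  [/\ map_of_genus (lmap u) g,
      injective (@lface k u),
      [set lface u i | i : 'I_k] = faces (lmap u),
      forall e : lmap u, llabel (sigma e) = llabel e
    & forall e : lmap u, `|llabel e - llabel (alpha e)| <= 1].

Definition iso_unrootedLM (k : nat) (u u' : unrootedLM k)
    (h : lmap u -> lmap u') : Prop :=
  [/\ map_iso h,
      forall i, h @: lface u i = lface u' i
    & exists c : int, forall e, llabel (h e) = llabel e + c].

Definition isoLM (k : nat) (u u' : rootedLM k) : Prop :=
  exists2 h : lmap u -> lmap u', iso_unrootedLM h & h (lroot u) = lroot u'.

Section Psi.
Variables (k : nat) (t : unrootedQ k).
Let q := qmap t.
Implicit Types (e f : q).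

Definition qlabel (v : {set q}) : int :=
  min_int [seq qdelay t i + (dist v (qsource t i))%:Z | i <- enum 'I_k].

Definition corner_label e : int := qlabel (origin e).

(* [e] is a half-edge of its face whose origin has lowest label [l]; the labels
   read counterclockwise are [l, l+1, l+2, l+1], resp. [l, l+1, l, l+1]. *)
Definition simple_from e : bool :=
  let l := corner_label e in
  [&& corner_label (phi e) == l + 1,
      corner_label (phi (phi e)) == l + 2
    & corner_label (phi (phi (phi e))) == l + 1].

Definition confluent_from e : bool :=
  let l := corner_label e in
  [&& corner_label (phi e) == l + 1,
      corner_label (phi (phi e)) == l
    & corner_label (phi (phi (phi e))) == l + 1].

(* [linked c c']: an edge is added between the corners [c] and [c'].  In a
   simple face the clockwise successor of the corner [phi (phi e)] of highest
   label is [phi e]. *)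
Definition linked_from e (c c' : q) : bool :=
  (simple_from e && ((c == phi (phi e)) && (c' == phi e)))
  || (confluent_from e && ((c == phi e) && (c' == phi (phi (phi e))))).

Definition linked : rel q :=
  fun c c' => [exists e, linked_from e c c' || linked_from e c' c].

Definition marked : pred q := fun c => [exists c' : q, linked c c'].

(* A corner is an end of at most one added edge, so the half-edges of the new
   map are encoded by the corners they leave from: the half-edge [c] of the new
   map lies between [c] and [sigma c]. *)
Definition new_half : finType := {c : q | marked c}.

Definition new_sigma (c : new_half) : new_half :=
  insubd c (iter (first_hit (@sigma q) marked (val c)) sigma (val c)).

Definition new_alpha (c : new_half) : new_half :=
  odflt c [pick c' : new_half | linked (val c) (val c')].

Definition new_map : premap := Premap new_sigma new_alpha.

(* The half-edges of the quadrangulation lying in the corner of the new map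
   incident to [c], that is, between [c] and [new_sigma c]. *)
Definition sector (c : new_map) : seq q :=
  traject sigma (sigma (val c)) (first_hit (@sigma q) marked (val c)).

(* The face of the new map containing the i-th source: edges of the
   quadrangulation do not cross the added edges, so a corner from which such an
   edge leads to the source is in that face. *)
Definition new_face (i : 'I_k) : {set new_map} :=
  [set e : new_map | [exists c : new_map, fconnect (@phi new_map) e c &&
              has (fun f => target f == qsource t i) (sector c)]].

Definition Psi_unrooted : unrootedLM k :=
  @UnrootedLM k new_map new_face (fun c => corner_label (val c)).

End Psi.

Section Successor.
Variables (k : nat) (u : unrootedLM k).

Definition source_label (i : 'I_k) : int :=
  min_int [seq llabel e | e <- enum (lface u i)] - 1.

(* The successor of a half-edge is either a source, given by its index, or a
   corner of the map. *)
Definition successor (e : lmap u) : 'I_k + lmap u :=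
  if [pick i | (e \in lface u i) && (llabel e == source_label i + 1)] is Some i
  then inl i
  else inr (iter (first_hit (@phi (lmap u)) (fun e' => llabel e' == llabel e - 1)
                            e)
                 (@phi (lmap u)) e).

End Successor.

(* [f] is the edge of the quadrangulation drawn from the corner incident to [e]
   to its successor, oriented accordingly. *)
Definition drawn (k : nat) (t : unrootedQ k) (e : lmap (Psi_unrooted t))
    (f : qmap t) : bool :=
  (f \in sector e) &&
  match successor e with
  | inl i => target f == qsource t i
  | inr e' => alpha f \in sector e'
  end.

(* [None] when no half-edge qualifies as the root, which does not happen on
   Q_{g,k}. *)
Definition Psi (k : nat) (t : rootedQ k) : option (rootedLM k) :=
  omap (fun e => @RootedLM k (Psi_unrooted t) e)
       [pick e : lmap (Psi_unrooted t)
          | drawn e (qroot t) || drawn e (alpha (qroot t))].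

(* Main.v *)
Require Import Defs.
From mathcomp Require Import all_boot all_order all_algebra zify.

(* A delay vector turns a bipartite quadrangulation into a labelled one: labels
   of adjacent vertices differ by exactly 1, and the local minima are exactly the
   sources.  A corner [c] is an end of an added edge iff [sigma c] is decreasing,
   so the half-edges of the new map correspond to the edges of the quadrangulation
   (oriented downwards), and reversal in the new map exchanges the two increasing
   half-edges of a face of the quadrangulation.  The key lemma, by descending
   induction on labels, follows a face of the new map from the corner of a
   decreasing half-edge to the first label that is not larger: it leads either to
   the next increasing half-edge around the lower endpoint, or to the corner in
   which the edge arrives.  Hence the faces of the new map correspond to the local
   minima, the drawn edges are the edges of the quadrangulation, and the latter is
   recovered by an explicit rotation system on pairs (corner, orientation).  That
   rotation system makes sense for every labelled map and inverts the unrooted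
   Psi.  The two preimages of a rooted map are the two orientations of the root
   edge; they are not isomorphic since isomorphisms preserve decreasing
   half-edges. *)

Set Implicit Arguments.
Unset Strict Implicit.
Unset Printing Implicit Defensive.
Import Order.TTheory GRing.Theory Num.Theory.
Local Open Scope ring_scope.

(** * Orbits and distances *)


(** What must be recovered without topology is the cyclic order of the drawn edges around each
    vertex. It is computable because of one fact: if the next corner [w] of the face after [e] with
    label at most [l e] has label exactly [l e], then [e] and [w] have the same successor. So the
    edges arriving at a corner are met in the order of these returns, until a corner of lower label
    closes the list. In the quadrangulation the same fact says that between two consecutive
    increasing half-edges at a vertex the face of the new map makes an excursion through strictly
    higher labels, which is analysed one level up; hence the induction from the highest label.
    Distances are confined to a few conversions: a labeling with steps of size 1, whose local minima
    are sources and which has the prescribed values at the sources, is the distance labeling. The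
    genus is carried over by counting: the vertices of the quadrangulation are those of the new map
    and one source per face, its faces correspond to the edges of the new map, and it has twice as
    many edges. Connectedness is not visible in these counts and is proved separately in both
    directions. *)

Lemma first_hit_spec (T : finType) (f : T -> T) (P : pred T) x n :
  (0 < n)%N -> P (iter n f x) ->
  [/\ (0 < first_hit f P x <= n)%N, P (iter (first_hit f P x) f x)
    & forall i, (0 < i < first_hit f P x)%N -> ~~ P (iter i f x)].
Proof.
case: n => // n _ Pn.
have hasP : has P (traject f (f x) #|T|).
  apply/hasP; exists (iter n.+1 f x) => //.
  have fc : fconnect f (f x) (iter n.+1 f x) by rewrite iterSr fconnect_iter.
  apply/trajectP; exists (findex f (f x) (iter n.+1 f x)); last by rewrite iter_findex.
  by apply: leq_trans (findex_max fc) _; apply: max_card.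
have lt := hasP; rewrite has_find size_traject in lt.
have before i : (0 < i < first_hit f P x)%N -> ~~ P (iter i f x).
  case: i => // i /andP[_]; rewrite /first_hit ltnS => lti.
  have := before_find (f x) lti; rewrite nth_traject; last exact: ltn_trans lti lt.
  by rewrite -iterSr => ->.
split => //.
  rewrite /= leqNgt; apply/negP => ltn.
  by have /negP := before n.+1 ltn; apply.
by have := nth_find (f x) hasP; rewrite nth_traject // -iterSr.
Qed.

Lemma first_hit_eq (T : finType) (f : T -> T) (P : pred T) x n :
  (0 < n)%N -> P (iter n f x) ->
  (forall i, (0 < i < n)%N -> ~~ P (iter i f x)) -> first_hit f P x = n.
Proof.
move=> n0 Pn before; have [/andP[h0 hn] hP _] := first_hit_spec n0 Pn.
apply/eqP; rewrite eqn_leq hn leqNgt; apply/negP => lt.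
by have := before _ (introT andP (conj h0 lt)); rewrite hP.
Qed.

(** Both images are counted by one chosen representative [r x] per fibre, on which [f] and [g] are
    injective. It serves to compare vertex sets that live in two different maps. *)
Lemma card_imset_same_fibers (T A B : finType) (f : T -> A) (g : T -> B)
    (D : {set T}) :
  {in D &, forall x y, (f x == f y) = (g x == g y)} -> #|f @: D| = #|g @: D|.
Proof.
move=> fg; pose r x := odflt x [pick y in D | f y == f x].
have rP x : x \in D -> r x \in D /\ f (r x) = f x.
  move=> xD; rewrite /r; case: pickP => [y /andP[yD /eqP] //|/(_ x)].
  by rewrite xD eqxx.
have rE x y : x \in D -> y \in D -> f x = f y -> r x = r y.
  move=> xD yD fxy; rewrite /r fxy; case: pickP => // /(_ y).
  by rewrite yD eqxx.
have gr x : x \in D -> g (r x) = g x.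
  by move=> xD; apply/eqP; rewrite -fg ?(rP x xD).2 ?eqxx ?(rP x xD).1.
have fi : {in r @: D &, injective f}.
  move=> _ _ /imsetP[x xD ->] /imsetP[y yD ->].
  by rewrite (rP x xD).2 (rP y yD).2; apply: rE.
have gi : {in r @: D &, injective g}.
  move=> _ _ /imsetP[x xD ->] /imsetP[y yD ->].
  by rewrite !gr // => /eqP; rewrite -fg // => /eqP; apply: rE.
have -> : f @: D = f @: (r @: D).
  rewrite -imset_comp; apply: eq_in_imset => x xD /=; exact/esym/(rP x xD).2.
have -> : g @: D = g @: (r @: D).
  by rewrite -imset_comp; apply: eq_in_imset => x xD /=; rewrite gr.
by rewrite (card_in_imset fi) (card_in_imset gi).
Qed.

Lemma iter_wrap (T : finType) (f : T -> T) (x : T) n :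
  injective f -> exists j, iter j f (iter n f x) = x.
Proof.
move=> fi; have : fconnect f (iter n f x) x by rewrite fconnect_sym // fconnect_iter.
by move/iter_findex; exists (findex f (iter n f x) x).
Qed.

Lemma iter_cancel (T : Type) (f g : T -> T) n :
  cancel f g -> cancel (iter n f) (iter n g).
Proof. by move=> fK x; elim: n => // n IH; rewrite iterSr iterS fK IH. Qed.

Lemma iter_inj (T : Type) (f : T -> T) n : injective f -> injective (iter n f).
Proof. by move=> fi; elim: n => //= n IH x y /fi/IH. Qed.

Lemma iter_finv_sub (T : finType) (f : T -> T) (x : T) n j :
  injective f -> (j <= n)%N -> iter j (finv f) (iter n f x) = iter (n - j) f x.
Proof.
move=> fi jn; rewrite -{1}(subnKC jn) iterD.
by apply: iter_cancel; apply: finv_f.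
Qed.

Lemma map_connect_sym (T : finType) (f g : T -> T) :
  injective f -> injective g -> connect_sym (fun a b => (f a == b) || (g a == b)).
Proof.
move=> fi gi; set R := fun a b => _.
have fR x y : fconnect f x y -> connect R x y.
  by apply: connect_sub => a b /eqP<-; apply: connect1; rewrite /R eqxx.
have gR x y : fconnect g x y -> connect R x y.
  by apply: connect_sub => a b /eqP<-; apply: connect1; rewrite /R eqxx orbT.
suff sub x y : connect R x y -> connect R y x by move=> x y; apply/idP/idP; apply: sub.
case/connectP=> p; elim: p x => [|z p IH] x /=; first by move=> _ ->; apply: connect0.
case/andP=> xz pz lz; apply: connect_trans (IH _ pz lz) _.
by case/orP: xz => /eqP<-; [apply: fR | apply: gR]; rewrite fconnect_sym // fconnect1.
Qed.

Section Orbits.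
Variables (m : premap) (f : m -> m).
Hypothesis finj : injective f.

Lemma mem_orbit_set (x y : m) : (y \in orbit_set f x) = fconnect f x y.
Proof. by rewrite inE. Qed.

Lemma orbit_set_refl (x : m) : x \in orbit_set f x.
Proof. by rewrite inE connect0. Qed.

Lemma orbit_set_eq x y : (orbit_set f x == orbit_set f y) = fconnect f x y.
Proof.
apply/eqP/idP => [E|fxy].
  by rewrite -mem_orbit_set E orbit_set_refl.
apply/setP => z; rewrite !inE; exact: (same_connect (fconnect_sym finj)).
Qed.

Lemma orbit_set_mem x y : y \in orbit_set f x -> orbit_set f y = orbit_set f x.
Proof. by rewrite inE -orbit_set_eq => /eqP->. Qed.

Lemma orbit_set1 x : orbit_set f (f x) = orbit_set f x.
Proof. by apply: orbit_set_mem; rewrite inE fconnect1. Qed.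

Lemma orbit_set_iter n x : orbit_set f (iter n f x) = orbit_set f x.
Proof. by apply: orbit_set_mem; rewrite inE fconnect_iter. Qed.

Lemma card_orbit_set x : #|orbit_set f x| = order f x.
Proof. by apply: eq_card => y; rewrite inE. Qed.

Lemma card_orbits n : (forall x, #|orbit_set f x| = n) ->
  (#|[set orbit_set f x | x : m]| * n = #|m|)%N.
Proof.
move=> cn; rewrite -cardsT; apply/esym/card_uniform_partition.
  by move=> _ /imsetP[x _ ->].
apply/and3P; split.
- rewrite eqEsubset subsetT; apply/subsetP => x _; apply/bigcupP.
  by exists (orbit_set f x); rewrite ?orbit_set_refl ?imset_f.
- apply/trivIsetP => _ _ /imsetP[x _ ->] /imsetP[y _ ->]; apply: contraNT.
  move=> /pred0Pn[z /andP[/= zx zy]].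
  by rewrite -(orbit_set_mem zx) -(orbit_set_mem zy).
- apply/imsetP => -[x _ E]; have := orbit_set_refl x; by rewrite -E inE.
Qed.

End Orbits.

Section Distance.
Variable m : premap.
Implicit Types (e : m) (u v w : {set m}).
Hypothesis sinj : injective (@sigma m).
Hypothesis ainv : involutive (@alpha m).

Lemma origin_refl e : e \in origin e.
Proof. exact: orbit_set_refl. Qed.

Lemma origin_mem e e' : e' \in origin e -> origin e' = origin e.
Proof. exact: orbit_set_mem. Qed.

Lemma origin_sigma e : origin (sigma e) = origin e.
Proof. exact: orbit_set1. Qed.

Lemma origin_in_vertices e : origin e \in vertices m.
Proof. exact: imset_f. Qed.

Lemma phiE e : phi e = finv sigma (alpha e).
Proof. by congr finv; rewrite -{1}[e]ainv finv_f //; exact: inv_inj. Qed.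

Lemma sigma_phi e : sigma (phi e) = alpha e.
Proof. by rewrite phiE f_finv. Qed.

Lemma phi_inj : injective (@phi m).
Proof.
move=> x y E; apply: (inv_inj ainv).
by rewrite -!sigma_phi E.
Qed.

Lemma adjacentP u v :
  reflect (exists2 e, origin e = u & target e = v) (adjacent u v).
Proof.
apply: (iffP existsP) => [[e /andP[/eqP<- /eqP<-]]|[e <- <-]]; exists e => //.
by rewrite !eqxx.
Qed.

Lemma adjacent_sym u v : adjacent u v = adjacent v u.
Proof.
by apply/adjacentP/adjacentP => -[e <- <-]; exists (alpha e); rewrite /target ?ainv.
Qed.

Lemma dist_le u v p : path (@adjacent m) u p -> last u p = v -> (dist u v <= size p)%N.
Proof.
move=> pp lp; rewrite leqNgt; apply/negP => lt.
have ltN : (size p < #|m|)%N.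
  apply: leq_trans lt _; rewrite /dist; apply: leq_trans (find_size _ _) _.
  by rewrite size_iota.
have := before_find 0%N lt; rewrite nth_iota // add0n => /existsP[].
by exists (in_tuple p); rewrite /= pp lp eqxx.
Qed.

Lemma dist_refl u : dist u u = 0%N.
Proof. by apply/eqP; rewrite -leqn0; apply: (@dist_le _ _ [::]). Qed.

Hypothesis conn :
  forall e e', connect (fun a b => (sigma a == b) || (alpha a == b)) e e'.

Lemma vertex_path e e' :
  exists2 p, path (@adjacent m) (origin e) p & last (origin e) p = origin e'.
Proof.
have /connectP[p] := conn e e'.
elim: p e => [|a p IH] e /=; first by move=> _ ->; exists [::].
move=> /andP[/orP[/eqP<-|/eqP<-] pp lp].
  by have := IH _ pp lp; rewrite origin_sigma.
have [s ps ls] := IH _ pp lp; exists (target e :: s) => //=.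
by rewrite ps andbT; apply/adjacentP; exists e.
Qed.

(** Connectedness supplies some walk and [shortenP] removes its repetitions; a walk without repeated
    vertices is short enough for the bounded search in [dist], since there are at most as many
    vertices as half-edges. *)
Lemma dist_path u v : u \in vertices m -> v \in vertices m ->
  exists p, [/\ path (@adjacent m) u p, last u p = v & size p = dist u v].
Proof.
move=> /imsetP[e _ ->] /imsetP[e' _ ->].
have [p0 pp0 lp0] := vertex_path e e'.
case/shortenP: pp0 lp0 => p pp up _ lp.
have sz : (size p < #|m|)%N.
  rewrite -ltnS -[(size p).+1]/(size (origin e :: p)).
  have <- := card_uniqP up.
  rewrite ltnS; apply: leq_trans (leq_imset_card (@origin m) m).
  apply/subset_leq_card/subsetP => x; rewrite inE => /orP[/eqP->|].
    exact: origin_in_vertices.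
  elim: p {up lp} (origin e) pp => //= y p IH z /andP[/adjacentP[a _ <-] pp].
  by rewrite inE => /orP[/eqP->|/(IH _ pp) //]; apply: imset_f.
have hs : has (fun n => [exists p : n.-tuple {set m},
   path (@adjacent m) (origin e) p && (last (origin e) p == origin e')]) (iota 0 #|m|).
  apply/hasP; exists (size p); first by rewrite mem_iota.
  by apply/existsP; exists (in_tuple p); rewrite /= pp lp eqxx.
have lt := hs; rewrite has_find size_iota in lt.
have /existsP[s /andP[ps /eqP ls]] := nth_find 0%N hs.
exists (tval s); rewrite ps ls; split=> //.
by rewrite size_tuple nth_iota // add0n.
Qed.

Lemma dist_adjacent e v : v \in vertices m ->
  (dist (origin e) v <= (dist (target e) v).+1)%N.
Proof.
move=> vV.
have [p [pp lp sp]] := dist_path (origin_in_vertices (alpha e)) vV.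
rewrite -sp.
apply: (@dist_le _ _ (target e :: p)) => //=.
by rewrite pp andbT; apply/adjacentP; exists e.
Qed.

Lemma dist_step u v : u \in vertices m -> v \in vertices m -> u <> v ->
  exists2 e, origin e = u & ((dist (target e) v).+1 <= dist u v)%N.
Proof.
move=> uV vV nuv; have [[|w p] [/= pp lp sp]] := dist_path uV vV; first by case: nuv.
rewrite -sp; case/andP: pp => /adjacentP[e eu ew] pp; exists e => //.
by rewrite ltnS; apply: dist_le; rewrite ew.
Qed.

Lemma dist_lipschitz (L : {set m} -> int) u v :
  (forall e, `|L (origin e) - L (target e)| <= 1) ->
  u \in vertices m -> v \in vertices m -> `|L u - L v| <= (dist u v)%:Z.
Proof.
move=> Ll uV vV; have [p [pp lp sp]] := dist_path uV vV; rewrite -sp -lp.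
elim: p u {uV sp lp} pp => [|w p IH] u /=; first by lia.
by move=> /andP[/adjacentP[e <- <-] pp]; have := IH _ pp; have := Ll e; lia.
Qed.

Lemma dist_parity (L : {set m} -> int) u v :
  (forall e, `|L (origin e) - L (target e)| = 1) ->
  u \in vertices m -> v \in vertices m -> (2 %| (dist u v)%:Z + L u - L v)%Z.
Proof.
move=> Ll uV vV; have [p [pp lp sp]] := dist_path uV vV; rewrite -sp -lp.
elim: p u {uV sp lp} pp => [|w p IH] u /=; first by lia.
by move=> /andP[/adjacentP[e <- <-] pp]; have := IH _ pp; have := Ll e; lia.
Qed.

End Distance.

(** * Drawing the edges of a labelled map *)

(** If the label there equals [l e], this is the next corner with the same successor as [e]. The
    scan stops at [e] itself at the latest, [P] being a permutation; with [finv P] it runs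
    backwards. *)
Definition next_low (m : finType) (P : m -> m) (l : m -> int) e :=
  iter (first_hit P (fun x => l x <= l e) e) P e.

Definition succ_corner (m : finType) (P : m -> m) (l : m -> int) e :=
  iter (first_hit P (fun x => l x == l e - 1) e) P e.

(* [(e, true)] is the edge drawn from the corner [e] to its successor, and
   [(e, false)] is its reversal. *)
Definition draw_sigma (m : finType) (S P : m -> m) (l : m -> int) (x : m * bool) :=
  let: (e, b) := x in
  if b then let w := P (next_low (finv P) l e) in
    if w == e then (S e, true) else (w, false)
  else let w := next_low P l e in
    if l w == l e then (w, false) else (S w, true).

(** Clockwise before [(e, true)] comes the last half-edge of the previous corner [P (A e)]: the edge
    arriving from [A e] if its label is [l e + 1], otherwise the outgoing edge of that corner.
    Before [(e, false)] comes the previous arrival at the same place or, if there is none, the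
    outgoing edge of the corner of arrival. *)
Definition draw_sigma_inv (m : finType) (A P : m -> m) (l : m -> int) (x : m * bool) :=
  let: (e, b) := x in
  if b then if l (A e) == l e + 1 then (A e, false) else (P (A e), true)
  else let v := next_low (finv P) l e in
    if l v == l e then (v, false) else (succ_corner P l e, true).

Lemma next_lowE (m : finType) (P : m -> m) (l : m -> int) e n :
  (0 < n)%N -> l (iter n P e) <= l e ->
  (forall i, (0 < i < n)%N -> l e < l (iter i P e)) -> next_low P l e = iter n P e.
Proof.
move=> n0 le h; rewrite /next_low (@first_hit_eq _ P _ e n) // => i /h.
by rewrite ltNge.
Qed.

Section NextLow.
Variables (m : finType) (P Q : m -> m) (l : m -> int).
Hypotheses (PK : cancel P Q) (QK : cancel Q P).
Hypothesis lP : forall e, `|l (P e) - l e| <= 1.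

Let P_inj : injective P := can_inj PK.

Lemma next_low_spec e : exists n, [/\ (0 < n)%N, next_low P l e = iter n P e,
  l (next_low P l e) <= l e & forall i, (0 < i < n)%N -> l e < l (iter i P e)].
Proof.
have le_e : l (iter (order P e) P e) <= l e by rewrite iter_order.
have [/andP[h0 _] h1 h2] := @first_hit_spec _ P (fun x => l x <= l e) _ _ (order_gt0 P e) le_e.
by exists (first_hit P (fun x => l x <= l e) e); split=> // i /h2; rewrite ltNge.
Qed.

Lemma next_low_step e : l (P e) <= l e -> next_low P l e = P e.
Proof. by move=> le; apply: (@next_lowE _ P l e 1) => // i; lia. Qed.

(* A return to a label [<= l e] other than by one step down is at level [l e]. *)
Lemma next_low_cases e : l (next_low P l e) = l e \/
  next_low P l e = P e /\ l (P e) = l e - 1.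
Proof.
have [[|[|n]] [// _ E le h]] := next_low_spec e.
  by rewrite E /= in le *; have := lP e;
    case: (eqVneq (l (P e)) (l e)); [left | right; split=> //; lia].
have := h n.+1; rewrite /= ltnSn => /(_ isT) lt; left.
by rewrite E /= in le *; have := lP (P (iter n P e)); lia.
Qed.

(** Two corners of equal label with only larger labels in between see each other from both sides. *)
Lemma next_low_back e : l (next_low P l e) = l e -> next_low Q l (next_low P l e) = e.
Proof.
have [n [n0 E _ h]] := next_low_spec e => El.
have back i : (i <= n)%N -> iter i Q (iter n P e) = iter (n - i) P e.
  by move=> lin; rewrite -{1}(subnKC lin) iterD iter_cancel.
rewrite (@next_lowE _ Q l _ n) //.
- by rewrite E back // subnn.
- by rewrite El E back // subnn.
move=> i /andP[i0 lt]; rewrite El E back ?(ltnW lt) //; apply: h.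
by rewrite subn_gt0 lt ltn_subrL i0.
Qed.

Lemma succ_cornerE e k : (0 < k)%N -> l (iter k P e) = l e - 1 ->
  (forall i, (0 < i < k)%N -> l e <= l (iter i P e)) -> succ_corner P l e = iter k P e.
Proof.
move=> k0 lk h; rewrite /succ_corner (@first_hit_eq _ P _ e k) ?lk //.
by move=> i /h; lia.
Qed.

(** Labels change by at most 1 along the face, so the first one below [l e] is exactly [l e - 1];
    this is why searching by an equality finds it. *)
Lemma succ_corner_spec e n : l (iter n P e) < l e -> exists k,
  [/\ (0 < k)%N, succ_corner P l e = iter k P e, l (iter k P e) = l e - 1
    & forall i, (i < k)%N -> l e <= l (iter i P e)].
Proof.
move=> ln; have ex : exists n, l (iter n P e) < l e by exists n.
case: (ex_minnP ex) => [[|k]]; first by rewrite ltxx.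
move=> lk hmin; have hk i : (i < k.+1)%N -> l e <= l (iter i P e).
  by move=> lt; rewrite leNgt; apply/negP => /hmin; lia.
have lk' : l (iter k.+1 P e) = l e - 1.
  by have := hk _ (ltnSn k); have := lP (iter k P e); rewrite /= in lk *; lia.
exists k.+1; split=> //; apply: succ_cornerE => // i /andP[_]; exact: hk.
Qed.

End NextLow.

Section Drawing.
Variables (m : finType) (S A P : m -> m) (l : m -> int).
Hypothesis P_inj : injective P.
Hypothesis A_inv : involutive A.
Hypothesis A_neq : forall e, A e != e.
Hypothesis SP : forall e, S (P e) = A e.
Hypothesis l_S : forall e, l (S e) = l e.
Hypothesis l_A : forall e, `|l e - l (A e)| <= 1.
Implicit Types e v w z : m.

Local Notation Q := (finv P).
Local Notation succ := (succ_corner P l).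
Local Notation sg := (draw_sigma S P l).
Local Notation gg := (draw_sigma_inv A P l).
Local Notation T := (next_low P l).
Local Notation Tb := (next_low (finv P) l).

Let PK : cancel P Q := finv_f P_inj.
Let QK : cancel Q P := f_finv P_inj.

Lemma l_P e : l (P e) = l (A e).
Proof. by rewrite -SP l_S. Qed.

Let lP e : `|l (P e) - l e| <= 1.
Proof. by rewrite l_P; have := l_A e; lia. Qed.

Let lQ e : `|l (Q e) - l e| <= 1.
Proof. by have := lP (Q e); rewrite QK; lia. Qed.

Let T_back e : l (T e) = l e -> Tb (T e) = e := next_low_back PK (e := e).
Let Tb_back e : l (Tb e) = l e -> T (Tb e) = e := next_low_back QK (e := e).

Lemma draw_sigma_invK : cancel gg sg.
Proof.
case=> e [] /=.
  case: eqP => [E|N] /=.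
    rewrite next_low_step ?l_P ?A_inv ?SP ?A_inv //; last by lia.
    by case: eqP => //; lia.
  have le : l (A e) <= l e by have := l_A e; lia.
  have -> : Tb (P (A e)) = A e.
    by rewrite next_low_step ?PK // l_P A_inv.
  by rewrite eqxx SP A_inv.
case: eqP => [E|N] /=; first by rewrite Tb_back // E eqxx.
have [//|[E lv]] := next_low_cases QK lQ e.
(* Going forwards all round the face reaches [Q e], whose label is lower, so the successor exists.
   Backwards from the successor all labels are at least [l e] until [Q e], reached after [k.+1]
   steps. *)
have [j Ej] : exists j, iter j P e = Q e.
  by exists (findex P e (Q e)); apply/iter_findex/fconnect_finv.
have [|k [k0 -> lk hk]] := @succ_corner_spec _ P l lP e j; first by rewrite Ej lv; lia.
have -> : Tb (iter k P e) = Q e.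
  rewrite (@next_lowE _ _ _ _ k.+1) //= ?iter_cancel // ?lv ?lk //.
  move=> i /andP[i0]; rewrite ltnS => le.
  by rewrite iter_finv_sub //; have := hk (k - i)%N; lia.
by rewrite QK; case: eqP => // E'; rewrite -E' in lk; lia.
Qed.

Lemma draw_sigmaK : cancel sg gg.
Proof. exact: canF_sym draw_sigma_invK. Qed.

Lemma draw_sigma_inj : injective sg.
Proof. exact: can_inj draw_sigmaK. Qed.

(** [(e, false)] leaves from the successor of [e], which lies one below [e] whether it is a corner
    or a source. *)
Definition draw_label (x : m * bool) : int := if x.2 then l x.1 else l x.1 - 1.

Lemma draw_label_sigma x : draw_label (sg x) = draw_label x.
Proof.
case: x => e [] /=.
  case: eqP => [_|N]; rewrite /draw_label /= ?l_S //.
  have [E|[E _]] := next_low_cases QK lQ e; last by rewrite E QK in N.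
  have [n [n0 En _ h]] := next_low_spec l QK e.
  (* With [n = 1] the corner after the backward return would be [e], against [N]. So that corner
     lies strictly inside the excursion and has label [l e + 1]. *)
  have n1 : (1 < n)%N by case: n n0 En {h} => [|[|n]] // _ En; rewrite En /= QK in N.
  have := h n.-1; case: n n0 n1 En {h} => // n _ n1 En; rewrite En /= QK.
  move=> /(_ ltac:(lia)); rewrite En /= in E.
  by have := lQ (iter n Q e); lia.
rewrite /draw_label; have [E|[E lE]] := next_low_cases PK lP e.
  by rewrite E eqxx /= E.
rewrite E lE; have -> : (l e - 1 == l e) = false by lia.
by rewrite /= l_S lE.
Qed.

Definition nonmin e := exists n, l (iter n P e) < l e.

(** The corner in which the half-edge starts. For [(e, false)] with [e] minimal in its face the
    start is a source and the value is junk, whence the [nonmin] conditions below. *)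
Definition owner (x : m * bool) : m := if x.2 then x.1 else succ x.1.

(** In a corner the outgoing edge comes first and the arriving edges follow, so a step stays in the
    corner or moves on to the outgoing edge of the next one. *)
Lemma owner_step (x : m * bool) : (x.2 \/ nonmin x.1) ->
  sg x = (S (owner x), true) \/
  [/\ (sg x).2 = false, nonmin (sg x).1 & owner (sg x) = owner x].
Proof.
case: x => e [] /= h.
  case: eqP => [E|N]; [by left | right].
  have [n [n0 En le hn]] := next_low_spec l QK e.
  case: n n0 En hn => [|[|n]] // _ En hn; first by rewrite En /= QK in N.
  rewrite En /= QK in le *.
  have hw := hn n.+1; rewrite /= ltnSn in hw; have {hw} lt := hw isT.
  have lw : l (Q (iter n Q e)) = l e + 1 by have := lQ (Q (iter n Q e)); lia.
  have ew : iter n.+1 P (Q (iter n Q e)) = e.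
    by rewrite -[Q _]/(iter n.+1 Q e) iter_cancel.
  split=> //; first by exists n.+1; rewrite ew lw; lia.
  rewrite /owner /= (@succ_cornerE _ P l _ n.+1) ?ew //; first by rewrite lw; lia.
  move=> i /andP[i0 lt'].
  rewrite -[Q (iter n Q e)]/(iter n.+1 Q e).
  have -> : n.+1 = (i + (n.+1 - i))%N by lia.
  rewrite iterD iter_cancel // -iterD subnKC; last by lia.
  by have := hn (n.+1 - i)%N; rewrite /= lw; lia.
have {}h : nonmin e by case: h.
have [n0 ln0] := h; have [k [k0 Ek lk hk]] := succ_corner_spec lP ln0.
have [E|[E lE]] := next_low_cases PK lP e.
  rewrite E eqxx; right.
  have [n [n1 En le hn]] := next_low_spec l PK e.
  have lt : (n < k)%N.
    rewrite ltnNge leq_eqVlt; apply/negP => /orP[/eqP En'|lt'].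
      by move: E; rewrite En -En' lk; lia.
    by have := hn k; rewrite k0 lt' lk; lia.
  have ek : iter (k - n) P (T e) = iter k P e.
    by rewrite En -iterD subnK ?(ltnW lt).
  split=> //; first by exists (k - n)%N; rewrite ek E lk; lia.
  rewrite /owner /= (@succ_cornerE _ P l (T e) (k - n)%N).
  - by rewrite ek Ek.
  - by rewrite subn_gt0.
  - by rewrite ek E.
  by move=> i /andP[_ lti]; rewrite E En -iterD; apply: hk; lia.
left; rewrite E lE; case: eqP => [|_]; first by lia.
by rewrite /owner /= (@succ_cornerE _ P l e 1) //; case.
Qed.

Lemma owner_sector e n :
  (forall i, (0 < i <= n)%N -> (iter i sg (e, true)).2 = false) ->
  [/\ owner (iter n sg (e, true)) = e
    & (iter n sg (e, true)).2 \/ nonmin (iter n sg (e, true)).1].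
Proof.
elim: n => [|n IH] h; first by split=> //; left.
have [|o1 o2] := IH; first by move=> i hi; apply: h; lia.
have := h n.+1; rewrite leqnn /= => /(_ isT).
have [->|[E1 E2 E3]] //= := owner_step o2.
by move=> _; rewrite E3 o1; split=> //; right.
Qed.

(** Skipping the arriving half-edges recovers the rotation of the original map; this will identify
    the [new_sigma] of the drawing. *)
Lemma draw_first_return e : exists2 n, (0 < n)%N && (iter n sg (e, true) == (S e, true))
  & forall i, (0 < i < n)%N -> (iter i sg (e, true)).2 = false.
Proof.
have ex : exists n, (0 < n)%N && (iter n sg (e, true)).2.
  exists (order sg (e, true)); rewrite order_gt0 iter_order //; exact: draw_sigma_inj.
case: (ex_minnP ex) => n /andP[n0 dn] hmin.
have hn i : (0 < i < n)%N -> (iter i sg (e, true)).2 = false.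
  move=> /andP[i0 lt]; apply/negP => d; have := hmin i; rewrite i0 d => /(_ isT).
  by lia.
exists n => //; rewrite n0 /=; case: n n0 dn hn {hmin} => // n _ dn hn.
have [o1 o2] := @owner_sector e n hn.
by have [/= ->|[E1 _ _]] := owner_step o2; [rewrite o1 | rewrite /= E1 in dn].
Qed.

Definition draw_phi (x : m * bool) := gg (x.1, ~~ x.2).
Local Notation pq := draw_phi.

(** The simple face around an edge of the map with increasing label: from [(e, false)] on, the
    origins have labels [l e - 1], [l e], [l e + 1], [l e]. *)
Lemma draw_phi_simple e : l (A e) = l e + 1 ->
  [/\ pq (e, false) = (A e, false), pq (A e, false) = (P e, true),
      pq (P e, true) = (T e, true) & pq (T e, true) = (e, false)].
Proof.
move=> E; rewrite /pq /= E eqxx A_inv; split=> //.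
- by case: eqP => //; lia.
- have -> : Tb (P e) = e by rewrite next_low_step ?PK // l_P; lia.
  case: eqP => [|_]; first by rewrite l_P; lia.
  have [n [n0 En le hn]] := next_low_spec l PK e.
  case: n n0 En hn => [|[|n]] // _ En hn; first by rewrite En /= l_P in le; lia.
  have [El|[En' _]] := next_low_cases PK lP e; last by rewrite En' l_P in le; lia.
  have eT : iter n.+1 P (P e) = T e by rewrite -iterSr En.
  rewrite (@succ_cornerE _ P l (P e) n.+1) // ?eT // ?El ?l_P; first by lia.
  move=> i hi; rewrite -iterSr; have := hn i.+1; lia.
- have [El|[En' _]] := next_low_cases PK lP e; first by rewrite T_back // El eqxx.
  have [n [_ _ le _]] := next_low_spec l PK e.
  by rewrite En' l_P in le; lia.
Qed.

(** The confluent face around an edge of the map with constant label: from [(e, false)] on, the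
    origins alternate between [l e - 1] and [l e]. *)
Lemma draw_phi_confluent e : l (A e) = l e ->
  [/\ pq (e, false) = (P (A e), true), pq (P (A e), true) = (A e, false),
      pq (A e, false) = (P e, true) & pq (P e, true) = (e, false)].
Proof.
move=> E; rewrite /pq /= E A_inv.
have -> : (l e == l e + 1) = false by lia.
have lPA : l (P (A e)) = l e by rewrite l_P A_inv.
have lPe : l (P e) = l e by rewrite l_P.
have -> : Tb (P (A e)) = A e by rewrite next_low_step ?PK // E lPA.
have -> : Tb (P e) = e by rewrite next_low_step ?PK // lPe.
by rewrite E lPA lPe eqxx.
Qed.

Definition in_phi_cycle x y := x \in [:: y; pq y; pq (pq y); pq (pq (pq y))].

(** Each face surrounds one edge of the map, taken here from an end of lowest label. For [(e, true)]
    it is the edge of [Q e] if the label rises from [Q e] to [e], and otherwise that of [Tb e],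
    whose forward return is [e]. *)
Lemma phi_cycle x : exists2 e, l e <= l (A e) & in_phi_cycle x (e, false).
Proof.
case: x => e b; have lA := l_A e; rewrite /in_phi_cycle.
case: b; last first.
  case: (lerP (l e) (l (A e))) => [le|lt]; first by exists e; rewrite // !inE eqxx.
  exists (A e); first by rewrite A_inv ltW.
  have [|-> _ _ _] := @draw_phi_simple (A e); first by rewrite A_inv; lia.
  by rewrite A_inv !inE eqxx orbT.
have [E|[E lE]] := next_low_cases QK lQ e; last first.
  have lq : l (A (Q e)) = l (Q e) + 1 by rewrite -l_P QK lE; lia.
  exists (Q e); first by lia.
  have [-> -> -> _] := draw_phi_simple lq; by rewrite QK !inE eqxx !orbT.
set v := Tb e in E; have eT : T v = e by apply: Tb_back.
have leA : l v <= l (A v).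
  rewrite leNgt; apply/negP => lt; move: eT; rewrite next_low_step ?l_P ?(ltW lt) //.
  by move=> eP; move: lt; rewrite -l_P eP E ltxx.
exists v => //; case: (eqVneq (l (A v)) (l v)) => [Ev|N].
  have [-> -> -> _] := draw_phi_confluent Ev.
  suff -> : P v = e by rewrite !inE eqxx !orbT.
  by rewrite -eT next_low_step // l_P Ev.
have lv : l (A v) = l v + 1 by have := l_A v; lia.
by have [-> -> -> _] := draw_phi_simple lv; rewrite eT !inE eqxx !orbT.
Qed.

Lemma draw_phi4 x : pq (pq (pq (pq x))) = x.
Proof.
have [e le] := phi_cycle x; rewrite /in_phi_cycle.
case: (eqVneq (l (A e)) (l e)) => [E|N].
  have [E1 E2 E3 E4] := draw_phi_confluent E; rewrite E1 E2 E3 !inE.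
  by case/or4P => /eqP->; rewrite ?(E1, E2, E3, E4).
have lv : l (A e) = l e + 1 by have := l_A e; lia.
have [E1 E2 E3 E4] := draw_phi_simple lv; rewrite E1 E2 E3 !inE.
by case/or4P => /eqP->; rewrite ?(E1, E2, E3, E4).
Qed.

Lemma draw_phi2_neq x : pq (pq x) != x.
Proof.
have [e le] := phi_cycle x; rewrite /in_phi_cycle.
case: (eqVneq (l (A e)) (l e)) => [E|N].
  have [E1 E2 E3 E4] := draw_phi_confluent E; rewrite E1 E2 E3 !inE.
  have An := A_neq e.
  case/or4P => /eqP->; rewrite ?(E1, E2, E3, E4) xpair_eqE ?andbT ?(inj_eq P_inj) //;
  by rewrite eq_sym.
have lv : l (A e) = l e + 1 by have := l_A e; lia.
have [E1 E2 E3 E4] := draw_phi_simple lv; rewrite E1 E2 E3 !inE.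
by case/or4P => /eqP->; rewrite ?(E1, E2, E3, E4) xpair_eqE /= andbF.
Qed.

(** The two half-edges of an edge of the map give the two increasing half-edges of one face; this
    will identify the [new_alpha] of the drawing. *)
Lemma draw_phi_A e : (A e, false) \in
  [:: pq (e, false); pq (pq (e, false)); pq (pq (pq (e, false)))].
Proof.
have lA := l_A e; rewrite !inE.
case: (ltgtP (l (A e)) (l e)) => [lt|lt|E].
- have [|E1 E2 E3 E4] := @draw_phi_simple (A e); first by rewrite A_inv; lia.
  by rewrite A_inv in E1 E2; rewrite E2 E3 E4 eqxx !orbT.
- have [|-> _ _ _] := @draw_phi_simple e; first by lia.
  by rewrite eqxx.
- by have [-> -> _ _] := draw_phi_confluent E; rewrite eqxx !orbT.
Qed.

(** With no lower label in the face every step is a return to the level of [e], so only arriving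
    edges are met: this orbit is the source of the face. *)
Lemma min_orbit e n : (forall i, l e <= l (iter i P e)) ->
  exists2 j, iter n sg (e, false) = (iter j P e, false) & l (iter j P e) = l e.
Proof.
move=> h; elim: n => [|n [j E lj]]; first by exists 0%N.
have [k [_ Ek _ _]] := next_low_spec l PK (iter j P e).
exists (k + j)%N; rewrite iterD -Ek.
  rewrite iterS E /=; case: eqP => // N.
  have [//|[_ lE]] := next_low_cases PK lP (iter j P e).
  by have := h j.+1; rewrite /= lE; lia.
have [-> //|[_ lE]] := next_low_cases PK lP (iter j P e).
by have := h j.+1; rewrite /= lE; lia.
Qed.

(** Each return brings the lower label strictly closer along the face, so after finitely many the
    label drops and an outgoing edge follows. *)
Lemma nonmin_orbit e : nonmin e -> exists i, (iter i sg (e, false)).2.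
Proof.
case=> n; elim/ltn_ind: n e => n IH e ln.
have [k [k0 Ek le hk]] := next_low_spec l PK e.
case: (eqVneq (l (T e)) (l e)) => [E|N]; last first.
  by exists 1%N => /=; case: eqP N.
have lt : (k < n)%N.
  case: (ltngtP k n) => // [lt|Ekn]; last by rewrite -Ekn -Ek E ltxx in ln.
  case: n ln lt {IH} => [|n] ln lt; first by rewrite ltxx in ln.
  by have := hk n.+1; rewrite lt => /(_ isT); lia.
have [||i hi] := IH (n - k)%N _ (T e).
- by lia.
- by rewrite [in X in _ < X]E Ek -iterD subnK ?(ltnW lt).
by exists i.+1; rewrite iterSr /= E eqxx.
Qed.

Lemma min_connect e n : (forall i, l e <= l (iter i P e)) ->
  l (iter n P e) = l e -> fconnect sg (e, false) (iter n P e, false).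
Proof.
elim/ltn_ind: n e => n IH e h ln.
case: (posnP n) => [->|n0]; first exact: connect0.
have [k [k0 Ek le hk]] := next_low_spec l PK e.
have E : l (T e) = l e.
  by apply/eqP; rewrite eq_le le Ek h.
have lt : (k <= n)%N.
  by rewrite leqNgt; apply/negP => lt; have := hk n; rewrite n0 lt ln ltxx => /(_ isT).
have lnk : (n - k < n)%N by lia.
have en : iter (n - k) P (T e) = iter n P e by rewrite Ek -iterD subnK.
apply: connect_trans (fconnect1 _ _) _; rewrite /= E eqxx -en; apply: IH => //.
  by move=> i; rewrite E Ek -iterD.
by rewrite en ln E.
Qed.

(** Every half-edge is joined to an outgoing one by reversal. Outgoing edges are joined along [S] by
    [draw_first_return] and along [A] because [draw_phi_A] puts their reversals in one face. *)
Lemma draw_connect :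
  (forall e e', connect (fun a b => (S a == b) || (A a == b)) e e') ->
  forall x y, connect (fun a b => (sg a == b) || ((a.1, ~~ a.2) == b)) x y.
Proof.
move=> hm; set R := fun a b => _.
have Rsym : connect_sym R.
  apply: map_connect_sym draw_sigma_inj _.
  by apply: inv_inj => -[e b] /=; rewrite negbK.
have flip x : connect R x (x.1, ~~ x.2) by apply: connect1; rewrite /R eqxx orbT.
have Rs x : connect R x (sg x) by apply: connect1; rewrite /R eqxx.
have Rp x : connect R x (pq x).
  apply: connect_trans (flip x) _; rewrite Rsym -[(x.1, ~~ x.2)]draw_sigma_invK.
  exact: Rs.
have Rdown e e' : connect R (e, true) (e', true).
  have /connectP[p] := hm e e'.
  elim: p e => [|z p IH] e /=; first by move=> _ ->; apply: connect0.
  case/andP=> /orP[]/eqP<- pz lz; apply: connect_trans (IH _ pz lz).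
    have [n /andP[_ /eqP<-] _] := draw_first_return e.
    by elim: n => [|n IHn]; [apply: connect0 | apply: connect_trans IHn (Rs _)].
  apply: connect_trans (flip _) _; apply: connect_trans (flip (A e, false)) => /=.
  have := draw_phi_A e; rewrite !inE; have r1 := Rp (e, false).
  have r2 := connect_trans r1 (Rp _); have r3 := connect_trans r2 (Rp _).
  by case/or3P=> /eqP->.
have toT x : connect R x (x.1, true).
  by case: x => e []; [apply: connect0 | apply: flip].
move=> x y; apply: connect_trans (toT x) _; apply: connect_trans (Rdown _ y.1) _.
by rewrite Rsym.
Qed.

End Drawing.

(** * The faces of the new map *)

(* [q], [s], [a], [p], [L] stand for the quadrangulation with its [sigma], [alpha],
   [phi] and labels, and [m], [S], [A], [P] for the new map; [dn c] is the unique
   decreasing half-edge in the corner [c], and [up c] its reversal. *)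
Section Derived.
Variables (q m : finType) (s a p : q -> q) (L : q -> int).
Variables (S A P : m -> m) (dn : m -> q).
Implicit Types (x y : q) (c z w : m).

Definition is_down x : bool := L (a x) == L x - 1.
Definition up c : q := a (dn c).
Definition in_sector c x : Prop :=
  exists2 n, x = iter n s (dn c)
    & forall i, (0 < i <= n)%N -> ~~ is_down (iter i s (dn c)).

Hypothesis s_inj : injective s.
Hypothesis a_inv : involutive a.
Hypothesis sp : forall x, s (p x) = a x.
Hypothesis p4 : forall x, p (p (p (p x))) = x.
Hypothesis L_s : forall x, L (s x) = L x.
Hypothesis L_a : forall x, `|L (a x) - L x| = 1.
Hypothesis dn_inj : injective dn.
Hypothesis dn_down : forall c, is_down (dn c).
Hypothesis dn_surj : forall x, is_down x -> exists c, dn c = x.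
Hypothesis dn_S : forall c, exists2 n, (0 < n)%N && (dn (S c) == iter n s (dn c))
    & forall i, (0 < i < n)%N -> ~~ is_down (iter i s (dn c)).
Hypothesis up_A : forall c,
  up (A c) \in [:: p (up c); p (p (up c)); p (p (p (up c)))].
Hypothesis A_inv : involutive A.
Hypothesis SP : forall c, S (P c) = A c.

Let lm c : int := L (dn c).

Lemma L_p x : L (p x) = L (a x).
Proof. by rewrite -sp L_s. Qed.

Lemma L_iter n x : L (iter n s x) = L x.
Proof. by elim: n => //= n <-. Qed.

Lemma is_down_a x : is_down (a x) = ~~ is_down x.
Proof. by rewrite /is_down a_inv; have := L_a x; lia. Qed.

Lemma is_downE x : is_down x = (L (p x) == L x - 1).
Proof. by rewrite /is_down L_p. Qed.

Lemma L_p_dist x : `|L (p x) - L x| = 1.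
Proof. by rewrite L_p L_a. Qed.

Lemma s_a x : s x = a (p (p (p x))).
Proof. by rewrite -sp p4. Qed.

Lemma up_inj : injective up.
Proof. by move=> c z /(inv_inj a_inv)/dn_inj. Qed.

Lemma dn_up c : dn c = a (up c).
Proof. by rewrite /up a_inv. Qed.

Lemma up_up c : ~~ is_down (up c).
Proof. by rewrite is_down_a negbK. Qed.

Lemma up_surj x : ~~ is_down x -> exists c, up c = x.
Proof.
rewrite -is_down_a => /dn_surj[c dc]; exists c.
by rewrite /up dc a_inv.
Qed.

Lemma L_up c : L (up c) = lm c - 1.
Proof. by have := dn_down c; rewrite /is_down -/(up c) /lm => /eqP. Qed.

Lemma sector_self c : in_sector c (dn c).
Proof. by exists 0%N => // i; lia. Qed.

Lemma sector_L c x : in_sector c x -> L x = lm c.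
Proof. by case=> n -> _; rewrite L_iter. Qed.

Lemma sector_down c x : in_sector c x -> is_down x -> x = dn c.
Proof.
case=> [[|n] -> h] //; have := h n.+1; rewrite leqnn /= => /(_ isT) /negP nd d.
by case: nd.
Qed.

Lemma sector_next c x : in_sector c x -> ~~ is_down (s x) -> in_sector c (s x).
Proof.
case=> n -> h nd; exists n.+1 => // i /andP[i0].
by rewrite leq_eqVlt => /orP[/eqP->|lei] //; apply: h; rewrite i0.
Qed.

Lemma sector_unique c z x : in_sector c x -> in_sector z x -> c = z.
Proof.
have aux n1 n2 c1 c2 : (n1 <= n2)%N -> iter n1 s (dn c1) = iter n2 s (dn c2) ->
    (forall i, (0 < i <= n2)%N -> ~~ is_down (iter i s (dn c2))) -> c1 = c2.
  move=> le12 E h; have E' : dn c1 = iter (n2 - n1) s (dn c2).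
    by apply: (@iter_inj _ s n1 s_inj); rewrite E -iterD subnKC.
  case: (posnP (n2 - n1)) => [n0|npos].
    by apply: dn_inj; rewrite E' n0.
  have := h (n2 - n1)%N; rewrite npos leq_subr /= -E' dn_down => /(_ isT) //.
case=> n1 -> h1 [n2 E h2]; case: (leqP n1 n2) => le; first exact: aux le E h2.
by apply/esym/(aux _ _ _ _ (ltnW le) (esym E)).
Qed.

Lemma sector_s c x : in_sector c x -> is_down (s x) -> s x = dn (S c).
Proof.
case=> n -> h d; have [k /andP[k0 /eqP ek] hk] := dn_S c; rewrite ek.
case: (ltngtP k n.+1) => [lt|lt|-> //].
  by have := h k; rewrite k0 -ltnS lt -ek dn_down => /(_ isT).
by have := hk n.+1; rewrite lt iterS d => /(_ isT).
Qed.

Lemma sector_exists x y : is_down y -> fconnect s x y -> exists c, in_sector c x.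
Proof.
rewrite fconnect_sym // => /dn_surj[c <-] /iter_findex <-.
elim: (findex _ _ _) => [|n [z hz]]; first by exists c; apply: sector_self.
case: (boolP (is_down (iter n.+1 s (dn c)))) => [d|nd].
  by exists (S z); rewrite /= (sector_s hz d); apply: sector_self.
by exists z; apply: sector_next.
Qed.

Lemma sector_orbit c x : in_sector c x -> fconnect s (dn c) x.
Proof. by case=> n -> _; apply: fconnect_iter. Qed.

(** A face has exactly two increasing half-edges, so [up (A c)], which is another half-edge of the
    face of [up c], must be the second one. The cases are: a simple face read from its lowest
    corner, a confluent face, and a simple face read from the middle corner that follows the
    lowest. *)
Lemma up_A_cases c (u := up c) :
  [\/ [/\ L (p (p u)) = L u + 2, L (p (p (p u))) = L u + 1 & up (A c) = p u],
      [/\ L (p (p u)) = L u, L (p (p (p u))) = L u + 1 & up (A c) = p (p u)]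
    | [/\ L (p (p u)) = L u, L (p (p (p u))) = L u - 1 & up (A c) = p (p (p u))]].
Proof.
have /negP := up_up (A c); rewrite is_downE => nA.
have := up_up c; rewrite is_downE -/u => nc.
have := L_p_dist u; have := L_p_dist (p u); have := L_p_dist (p (p u)).
have := L_p_dist (p (p (p u))); rewrite p4 => d3 d2 d1 d0.
have := up_A c; rewrite -/u !inE => /or3P[]/eqP E; rewrite E ?p4 in nA.
- by constructor 1; split=> //; lia.
- by constructor 2; split=> //; lia.
- by constructor 3; split=> //; lia.
Qed.

Lemma up_A_unique c z :
  up z \in [:: p (up c); p (p (up c)); p (p (p (up c)))] -> A c = z.
Proof.
have := up_up z; rewrite is_downE !inE => nz E; apply: up_inj.
have := L_p_dist (up c); have := up_up c; rewrite is_downE => nc dc.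
case: (up_A_cases c) => [[l2 l3 ->]|[l2 l3 ->]|[l2 l3 ->]];
  by case/or3P: E => /eqP E; rewrite E ?p4 in nz *; rewrite // ?l2 ?l3 in nz; lia.
Qed.

Lemma S_unique c z n : (0 < n)%N -> iter n s (dn c) = dn z ->
  (forall i, (0 < i < n)%N -> ~~ is_down (iter i s (dn c))) -> S c = z.
Proof.
case: n => // n _ E h; apply: dn_inj.
rewrite -(@sector_s c (iter n s (dn c))) -?iterS ?E //.
by exists n => // i /andP[i0 le]; apply: h; rewrite i0 ltnS.
Qed.

(** This half-edge comes just before [dn (A c)], which is [dn (S (P c))]; so it is the last one of
    the corner [P c]. *)
Lemma sector_P c : in_sector (P c) (p (up (A c))).
Proof.
case: (dn_S (P c)) => [[//|n]] /andP[_ /eqP E] h; exists n => [|i /andP[i0 le]].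
  by apply: s_inj; rewrite -iterS -E SP sp dn_up.
by apply: h; rewrite i0 ltnS.
Qed.

Lemma sector_last c : exists2 x, in_sector c x & s x = dn (S c).
Proof.
case: (dn_S c) => [[//|n]] /andP[_ /eqP E] h; exists (iter n s (dn c)) => //.
by exists n => // i /andP[i0 le]; apply: h; rewrite i0 ltnS.
Qed.

Lemma S_inj : injective S.
Proof.
move=> c z E; have [x hx Ex] := sector_last c; have [y hy Ey] := sector_last z.
by apply: (sector_unique hx); rewrite (s_inj (_ : s x = s y)) // Ex Ey E.
Qed.

Lemma P_inj : injective P.
Proof. by move=> c z E; apply: (inv_inj A_inv); rewrite -!SP E. Qed.

Lemma lm_bound : exists M : int, forall c, `|lm c| <= M.
Proof.
exists (\max_c `|lm c|%N)%:Z => c.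
have := @leq_bigmax _ (fun c => `|lm c|%N) c; lia.
Qed.

(** The hypothesis leaves only the third case of [up_A_cases], where [p (up (A c))] is [up c] itself
    and [sector_P] applies. *)
Lemma iter_P_up_down c : is_down (s (up c)) -> in_sector (P c) (up c).
Proof.
rewrite s_a is_down_a is_downE p4 => d.
case: (up_A_cases c) => [[_ l _]|[_ l _]|[_ _ E]]; try by lia.
by have := sector_P c; rewrite E p4.
Qed.

Lemma lm_eq_up c z : L (up z) = L (up c) -> lm z = lm c.
Proof. by rewrite !L_up; lia. Qed.

(* Levels are treated from the highest label down. *)
Lemma sector_hits_at_level l :
  (forall c, lm c = l -> ~~ is_down (s (up c)) ->
    exists2 j, (0 < j)%N && (up (iter j P c) == s (up c))
      & forall i, (0 < i < j)%N -> lm c < lm (iter i P c)) ->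
  forall c z, lm c = l -> in_sector z (up c) ->
    exists2 j, (0 < j)%N && (iter j P c == z)
      & forall i, (0 < i < j)%N -> lm c <= lm (iter i P c).
Proof.
move=> Hup c z lc sz.
(* [N.+1] steps of [s] lead from [up c] to a decreasing half-edge. Each use of [Hup] spends one of
   them, staying in the corner [z] and at the level of [c]. *)
have [N dN] : exists N, is_down (iter N.+1 s (up c)).
  have : fconnect s (s (up c)) (dn z).
    rewrite -same_fconnect1 // fconnect_sym //; exact: sector_orbit sz.
  move=> /iter_findex E; exists (findex s (s (up c)) (dn z)).
  by rewrite iterSr E.
elim: N c lc sz dN => [|N IH] c lc sz dN.
  exists 1%N => [|i]; last by lia.
  by rewrite /= (sector_unique (iter_P_up_down dN) sz).
case: (boolP (is_down (s (up c)))) => [d|nd].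
  exists 1%N => [|i]; last by lia.
  by rewrite /= (sector_unique (iter_P_up_down d) sz).
have [j /andP[j0 /eqP uj] hj] := Hup _ lc nd.
have lj : lm (iter j P c) = lm c by apply: lm_eq_up; rewrite uj L_s.
have sj : in_sector z (up (iter j P c)) by rewrite uj; apply: sector_next.
have [||j' /andP[j'0 /eqP Ej'] hj'] := IH _ _ sj; first by rewrite lj.
  by rewrite uj -iterSr.
exists (j' + j)%N; first by rewrite addn_gt0 j0 orbT iterD Ej' eqxx.
move=> i; case: (ltngtP i j) => [lt /andP[i0 _]|lt|->] ; last by rewrite lj.
  by apply/ltW/hj; rewrite i0.
move=> /andP[_ lt']; rewrite -(subnK (ltnW lt)) iterD -lj; apply: hj'.
by rewrite subn_gt0 lt ltn_subLR ?(ltnW lt) // addnC.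
Qed.

(** In a confluent face [P c] already works. In a simple face read from its lowest corner, [P c] is
    one level higher and its edge arrives in the corner [z] with [up z = s (up c)]; the statement
    for corners, one level up, then leads from [P c] to [z]. The bound [M] on the labels grounds the
    induction. *)
Lemma iter_P_up c : ~~ is_down (s (up c)) ->
    exists2 j, (0 < j)%N && (up (iter j P c) == s (up c))
      & forall i, (0 < i < j)%N -> lm c < lm (iter i P c).
Proof.
have [M hM] := lm_bound.
have : M - lm c < (`|M - lm c|.+1)%:Z by lia.
move: (`|M - lm c|.+1)%N => n0; elim: n0 c => [|n IH] c lt nd; first by have := hM c; lia.
have d3 : is_down (p (p (p (up c)))) by move: nd; rewrite s_a is_down_a negbK.
case: (up_A_cases c) => [[l2 l3 E]|[l2 l3 E]|[l2 l3 _]].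
- have dP : dn (P c) = p (p (up c)).
    apply/esym/sector_down; first by rewrite -E; apply: sector_P.
    by rewrite is_downE l2 l3; lia.
  have [z dz] := dn_surj d3.
  have uw : up (P c) = s (dn z) by rewrite /up dP dz sp.
  have sz : in_sector z (up (P c)).
    by rewrite uw; apply: sector_next (sector_self z) _; rewrite -uw up_up.
  have lP : lm (P c) = lm c + 1 by rewrite /lm dP l2 L_up /lm; lia.
  have [|j /andP[j0 /eqP Ej] hj] := @sector_hits_at_level (lm (P c)) _ _ _ erefl sz.
    by move=> c' lc' nd'; apply: IH => //; rewrite lc' lP; lia.
  exists j.+1; first by rewrite iterSr Ej /up dz s_a /= eqxx.
  case=> [|[|i]] //; first by rewrite /= lP; lia.
  by rewrite ltnS (iterSr i.+1) => h; have := hj i.+1 h; rewrite lP; lia.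
- exists 1%N => [|i]; last by lia.
  have dP : dn (P c) = p (p (p (up c))).
    by apply/esym/sector_down => //; rewrite -E; apply: sector_P.
  by rewrite /= /up dP -s_a eqxx.
- by move: d3; rewrite is_downE p4; lia.
Qed.

Lemma iter_P_sector c z : in_sector z (up c) ->
    exists2 j, (0 < j)%N && (iter j P c == z)
      & forall i, (0 < i < j)%N -> lm c <= lm (iter i P c).
Proof.
by move=> sz; apply: (@sector_hits_at_level (lm c)) => // c' _; apply: iter_P_up.
Qed.

Definition around_source x := forall i, ~~ is_down (iter i s x).

Lemma around_source_s x : around_source x -> around_source (s x).
Proof. by move=> h i; rewrite -iterSr. Qed.

Lemma around_source_or_sector c : around_source (up c) \/ exists z, in_sector z (up c).
Proof.
case: (boolP [exists y, fconnect s (up c) y && is_down y]).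
  by case/existsP=> y /andP[fy d]; right; apply: sector_exists d fy.
move=> /existsPn h; left=> i; apply/negP => d.
by have := h (iter i s (up c)); rewrite fconnect_iter d.
Qed.

(** By [iter_P_up] the face goes round the source, meeting [up c], [s (up c)] and so on in turn with
    strictly higher labels in between. Hence [lm c] is the minimum of the face, attained only at
    corners whose edge leads to that source. *)
Lemma source_face_min c n : around_source (up c) ->
  lm c <= lm (iter n P c) /\
  (lm (iter n P c) = lm c -> fconnect s (up c) (up (iter n P c))).
Proof.
elim/ltn_ind: n c => n IH c hc.
have [j /andP[j0 /eqP uj] hj] := iter_P_up (hc 1%N).
have lj : lm (iter j P c) = lm c by apply: lm_eq_up; rewrite uj L_s.
case: (ltnP n j) => [lt|le].
  case: (posnP n) => [->|n0]; first by split=> //= _; apply: connect0.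
  have := hj n; rewrite n0 lt => /(_ isT) h; split; first exact: ltW.
  by move=> E; rewrite E ltxx in h.
have [||h1 h2] := IH (n - j)%N _ (iter j P c); first by lia.
  by rewrite uj; apply: around_source_s.
rewrite -iterD subnK // lj in h1 h2; split=> // /h2; rewrite uj.
by rewrite -same_fconnect1.
Qed.

Lemma source_face_reach c i : around_source (up c) ->
  exists n, up (iter n P c) = iter i s (up c).
Proof.
move=> hc; elim: i => [|i [n E]]; first by exists 0%N.
have [|j /andP[_ /eqP Ej] _] := @iter_P_up (iter n P c).
  by rewrite E -iterS; apply: hc.
by exists (j + n)%N; rewrite iterD Ej E.
Qed.

(** Unless the edge of [c] leads to a source, it arrives in a corner of the same face one level
    lower, and labels are bounded below. *)
Lemma face_has_source c : exists n, around_source (up (iter n P c)).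
Proof.
have [M hM] := lm_bound.
have : lm c + M < (absz (lm c + M)).+1%:Z by lia.
move: (absz (lm c + M)).+1 => n0; elim: n0 c => [|n IH] c lt; first by have := hM c; lia.
have [hc|[z sz]] := around_source_or_sector c; first by exists 0%N.
have [j /andP[_ /eqP Ej] _] := iter_P_sector sz.
have [|i hi] := IH z; first by have := sector_L sz; rewrite L_up; lia.
by exists (i + j)%N; rewrite iterD Ej.
Qed.

Lemma iter_S_sector c n : exists j, in_sector (iter j S c) (iter n s (dn c)).
Proof.
elim: n => [|n [j hj]]; first by exists 0%N; apply: sector_self.
case: (boolP (is_down (iter n.+1 s (dn c)))) => d.
  by exists j.+1; rewrite /= (sector_s hj d); apply: sector_self.
by exists j; apply: sector_next.
Qed.

Lemma fconnect_S c z : fconnect S c z = fconnect s (dn c) (dn z).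
Proof.
apply/idP/idP => /iter_findex.
  move=> <-; elim: (findex _ _ _) => //= n IH.
  have [k /andP[_ /eqP ->] _] := dn_S (iter n S c).
  exact: connect_trans IH (fconnect_iter _ _ _).
move=> E; have [j] := iter_S_sector c (findex s (dn c) (dn z)).
by rewrite E => /(sector_unique (sector_self z)) ->; apply: fconnect_iter.
Qed.

(** A face cannot contain two sources: corners leading to them would both have the minimal label of
    the face, and [source_face_min] puts their edges around one vertex. *)
Lemma fconnect_P c z : around_source (up c) -> around_source (up z) ->
  fconnect P c z = fconnect s (up c) (up z).
Proof.
move=> hc hz; apply/idP/idP => [cz|/iter_findex].
  have [n Ez] : exists n, z = iter n P c by exists (findex P c z); rewrite iter_findex.
  have [h1 h2] := source_face_min n hc.
  have [j Ej] : exists j, iter j P z = c.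
    rewrite Ez; apply: iter_wrap => x y E.
    exact: P_inj E.
  have [h3 _] := source_face_min j hz.
  rewrite Ez; apply: h2; apply/eqP; rewrite eq_le h1 andbT.
  by move: h3; rewrite Ej Ez.
have [n <-] := source_face_reach (findex s (up c) (up z)) hc.
by move=> /up_inj <-; apply: fconnect_iter.
Qed.

(** A path in [q] is followed by the unique [c] with [dn c] or [up c] equal to the current
    half-edge: [a] keeps [c], and [s] changes it within its class, by one of four arguments
    according to the two orientations. *)
Lemma derived_connect :
  (forall x y, connect (fun b b' => (s b == b') || (a b == b')) x y) ->
  forall c z, connect (fun b b' => (S b == b') || (A b == b')) c z.
Proof.
move=> hq; set R := fun b b' => _.
have Rsym : connect_sym R := map_connect_sym S_inj (inv_inj A_inv).
have RS c : connect R c (S c) by apply: connect1; rewrite /R eqxx.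
have RA c : connect R c (A c) by apply: connect1; rewrite /R eqxx orbT.
have RP c : connect R c (P c).
  by apply: connect_trans (RA c) _; rewrite Rsym -SP.
have RPn n c : connect R c (iter n P c).
  by elim: n => [|n IH]; [apply: connect0 | apply: connect_trans IH (RP _)].
pose ends c x := x = dn c \/ x = up c.
have ends_s x c z : ends c x -> ends z (s x) -> connect R c z.
  case=> -> [] E.
  - have d : is_down (s (dn c)) by rewrite E dn_down.
    by move: E; rewrite (sector_s (sector_self c) d) => /dn_inj <-.
  - have sz : in_sector c (up z).
      by rewrite -E; apply: sector_next (sector_self c) _; rewrite E up_up.
    by have [j /andP[_ /eqP <-] _] := iter_P_sector sz; rewrite Rsym.
  - have d : is_down (s (up c)) by rewrite E dn_down.
    move: E; rewrite (sector_s (iter_P_up_down d) d) => /dn_inj <-.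
    by rewrite SP.
  - have [|j /andP[_ /eqP Ej] _] := @iter_P_up c; first by rewrite E up_up.
    by move: Ej; rewrite E => /up_inj <-.
have ends_a x c z : ends c x -> ends z (a x) -> c = z.
  case=> -> [] E.
  - by have := up_up c; rewrite /up E dn_down.
  - exact: up_inj.
  - by apply: dn_inj; rewrite dn_up.
  - by have := up_up z; rewrite -E -dn_up dn_down.
have endsP x : exists c, ends c x.
  case: (boolP (is_down x)) => [/dn_surj|/up_surj] [c <-]; exists c; by [left|right].
move=> c z; have /connectP[pth] := hq (dn c) (dn z).
have : ends c (dn c) by left.
elim: pth c (dn c) => [|y pth IH] c x ex /=.
  move=> _ E; suff -> : z = c by apply: connect0.
  case: ex => E'; first by apply: dn_inj; rewrite E.
  by have := up_up c; rewrite -E' -E dn_down.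
case/andP=> /orP[]/eqP xy py ly; have [w ew] := endsP y.
  by apply: connect_trans (IH w _ ew py ly); apply: (ends_s x); rewrite ?xy.
by rewrite (ends_a x c w) ?xy //; apply: IH ew py ly.
Qed.

Lemma lm_S c : lm (S c) = lm c.
Proof. by rewrite /lm; have [n /andP[_ /eqP->] _] := dn_S c; rewrite L_iter. Qed.

Lemma lm_A c : `|lm c - lm (A c)| <= 1.
Proof.
have := L_up c; have := L_up (A c); have := L_p_dist (up c).
have := L_p_dist (p (up c)).
by case: (up_A_cases c) => [[l2 l3 ->]|[l2 l3 ->]|[l2 l3 ->]]; lia.
Qed.

Definition drawn_edge (x : m * bool) : q := if x.2 then dn x.1 else up x.1.

Lemma drawn_edge_bij : bijective drawn_edge.
Proof.
apply: inj_card_bij.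
  move=> [c b] [z b']; rewrite /drawn_edge /=.
  case: b; case: b' => E.
  - by rewrite (dn_inj E).
  - by have := up_up z; rewrite -E dn_down.
  - by have := up_up c; rewrite E dn_down.
  - by rewrite (up_inj E).
rewrite card_prod card_bool.
have sub x : x \in [seq drawn_edge y | y : m * bool].
  apply/mapP; case: (boolP (is_down x)) => [/dn_surj|/up_surj] [c <-].
    by exists (c, true); rewrite ?mem_enum.
  by exists (c, false); rewrite ?mem_enum.
have := @subset_leq_card _ (mem q) (mem [seq drawn_edge y | y : m * bool]).
rewrite -card_bool -card_prod => h; apply: leq_trans (h _) (leq_trans (card_size _) _).
  by apply/subsetP => x _; apply: sub.
by rewrite size_map -cardE.
Qed.

Lemma drawn_edge_alpha c b : a (drawn_edge (c, b)) = drawn_edge (c, ~~ b).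
Proof. by case: b; rewrite /drawn_edge /= /up ?a_inv. Qed.

(** For [up c] this is a reformulation of the key lemma. For [dn c] it follows from injectivity: the
    preimage of [s (dn c)] under the rotation cannot be some [(w, false)], whose image is already
    [s (up w)], so [draw_sigma_inv] must give an outgoing edge and only its corner remains to be
    identified. *)
Lemma drawn_edge_sigma (x : m * bool) : s (drawn_edge x) = drawn_edge (draw_sigma S P lm x).
Proof.
have up_case c : s (up c) = drawn_edge (draw_sigma S P lm (c, false)).
  case: (boolP (is_down (s (up c)))) => [d|nd] /=.
    have sP := iter_P_up_down d; have lP : lm (P c) = lm c - 1.
      by rewrite -(sector_L sP) L_up.
    rewrite next_low_step lP; last by lia.
    have -> : (lm c - 1 == lm c) = false by lia.
    by rewrite /drawn_edge /= -(sector_s sP d).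
  have [j /andP[j0 /eqP uj] hj] := iter_P_up nd.
  have lj : lm (iter j P c) = lm c by apply: lm_eq_up; rewrite uj L_s.
  by rewrite (next_lowE j0) ?lj // eqxx /drawn_edge /= uj.
case: x => c []; last exact: up_case.
have [E' EK KE] := drawn_edge_bij.
rewrite -[drawn_edge (c, true)]/(dn c) -[s (dn c)]KE; congr drawn_edge.
set y := E' (s (dn c)); have yE : drawn_edge y = s (dn c) by rewrite KE.
have sgK := draw_sigma_invK P_inj A_inv SP lm_S lm_A.
rewrite -[y]sgK; congr (draw_sigma S P lm _).
have notup w : draw_sigma_inv A P lm y <> (w, false).
  move=> Ew; have := up_case w; rewrite -Ew sgK yE => /s_inj E.
  by have := up_up w; rewrite E dn_down.
case: y yE notup => w [] yE notup /=.
  have d : is_down (s (dn c)) by rewrite -yE dn_down.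
  move: notup => /=; case: eqP => [_ /(_ (A w))//|_ _]; congr (_, _).
  apply: S_inj; rewrite SP A_inv; apply: dn_inj.
  by rewrite -(sector_s (sector_self c) d) -yE.
move: notup => /=; case: eqP => [_ /(_ (next_low (finv P) lm w)) //|_ _]; congr (_, _).
have sw : in_sector c (up w).
  have -> : up w = s (dn c) by [].
  by apply: sector_next (sector_self c) _; rewrite -yE up_up.
have [j /andP[j0 /eqP Ej] hj] := iter_P_sector sw.
rewrite (@succ_cornerE _ P lm w j) //.
by rewrite Ej -(sector_L sw) L_up.
Qed.

End Derived.

(** * The new map of a labelled quadrangulation *)

Section FaceLinks.
Variables (T : finType) (p : T -> T) (L : T -> int).
Hypothesis p4 : forall x, p (p (p (p x))) = x.
Hypothesis L_p_dist : forall x, `|L (p x) - L x| = 1.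

(** The other end of the added edge when [x] is, in this order, the middle corner after the lowest
    one of a simple face, a highest corner of a confluent face, or the highest corner of a simple
    face. At other corners the value is junk. *)
Definition partner x : T :=
  if L (p x) == L x + 1 then p x
  else if L (p (p x)) == L x then p (p x) else p (p (p x)).

Definition face_link e c c' : bool :=
  [&& L (p e) == L e + 1, L (p (p e)) == L e + 2 & L (p (p (p e))) == L e + 1]
    && ((c == p (p e)) && (c' == p e))
  || [&& L (p e) == L e + 1, L (p (p e)) == L e & L (p (p (p e))) == L e + 1]
    && ((c == p e) && (c' == p (p (p e)))).

(** [p (p (p x))] is the previous corner of the face, so the label condition says that the side
    ending at [x] is increasing. Each face has two such corners, and the added edge joins them. *)
Lemma face_linkP x y :
  [exists e, face_link e x y || face_link e y x] =
    (L (p (p (p x))) == L x - 1) && (y == partner x).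
Proof.
apply/existsP/andP.
  case=> e /orP[]/orP[]/andP[/and3P[/eqP l1 /eqP l2 /eqP l3] /andP[/eqP-> /eqP->]].
  - rewrite /partner !p4 l1 l2 l3; split; first by lia.
    have -> : (L e + 1 == L e + 2 + 1) = false by lia.
    by have -> : (L e == L e + 2) = false by lia.
  - rewrite /partner !p4 l1 l2 l3; split; first by lia.
    have -> : (L e == L e + 1 + 1) = false by lia.
    by rewrite eqxx.
  - rewrite /partner !p4 l1 l2; split; first by lia.
    by have -> : (L e + 2 == L e + 1 + 1) by lia.
  - rewrite /partner !p4 l1 l2 l3; split; first by lia.
    have -> : (L e == L e + 1 + 1) = false by lia.
    by rewrite eqxx.
move=> [/eqP l3 /eqP->].
have d0 := L_p_dist x; have d1 := L_p_dist (p x); have d2 := L_p_dist (p (p x)).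
rewrite /partner /face_link.
case: (eqVneq (L (p x)) (L x + 1)) => [e1|n1].
  by exists (p (p (p x))); rewrite !p4 !eqxx /=; lia.
case: (eqVneq (L (p (p x))) (L x)) => [e2|n2].
  by exists (p x); rewrite !p4 !eqxx /=; lia.
by exists (p (p x)); rewrite !p4 !eqxx /=; lia.
Qed.

Lemma partner_mem x (u := p (p (p x))) :
  p (p (p (partner x))) \in [:: p u; p (p u); p (p (p u))].
Proof.
rewrite /u !p4 /partner !inE.
by case: ifP => _; [|case: ifP => _]; rewrite ?p4 eqxx ?orbT.
Qed.

End FaceLinks.

Lemma orbit4 (T : finType) (f : T -> T) (x : T) : injective f -> order f x = 4%N ->
  f (f (f (f x))) = x /\ f (f x) <> x.
Proof.
move=> fi o4; split; first by have := iter_order fi x; rewrite o4.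
have := orbit_uniq f x; rewrite /orbit o4 /= !inE !negb_or => /andP[/and3P[_ n _] _] E.
by rewrite E eqxx in n.
Qed.

(** This replaces membership in Q for most of the proof: distances enter only through
    [corner_label], and [lq_source] characterises the sources as the local minima. [in_Q_labelled]
    and [labelled_in_Q] translate between the two. *)
Record labelled_quadrangulation (k : nat) (t : unrootedQ k) : Prop := LabelledQuad {
  lq_sigma : injective (@sigma (qmap t));
  lq_alpha : involutive (@alpha (qmap t));
  lq_quad : quadrangulation (qmap t);
  lq_label : forall e : qmap t, `|corner_label (alpha e) - corner_label e| = 1;
  lq_source : forall e : qmap t, (exists i, origin e = qsource t i) <->
    (forall e', e' \in origin e -> corner_label (alpha e') = corner_label e' + 1);
  lq_vertex : forall i, qsource t i \in vertices (qmap t);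
  lq_inj : injective (@qsource k t);
  lq_delay : forall i (e : qmap t), origin e = qsource t i -> corner_label e = qdelay t i }.

Section LabelledQuadrangulation.
Variables (k : nat) (t : unrootedQ k).
Hypothesis G : labelled_quadrangulation t.
Local Notation q := (qmap t).
Local Notation M := (new_map t).
Local Notation cl := (@corner_label k t).
Local Notation P := (@phi M).
Implicit Types (x y : q) (c z : M).

Let s_inj : injective (@sigma q) := lq_sigma G.
Let a_inv : involutive (@alpha q) := lq_alpha G.

Lemma lq_sp x : sigma (phi x) = alpha x.
Proof. exact: (sigma_phi s_inj a_inv). Qed.

Lemma lq_phi4 x : phi (phi (phi (phi x))) = x /\ phi (phi x) <> x.
Proof.
apply: orbit4; first exact: (phi_inj s_inj a_inv).
by rewrite -card_orbit_set; apply: (lq_quad G); apply: imset_f.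
Qed.

Let p4 x : phi (phi (phi (phi x))) = x := (lq_phi4 x).1.

Lemma cl_origin x y : origin x = origin y -> cl x = cl y.
Proof. by rewrite /corner_label => ->. Qed.

Lemma cl_sigma x : cl (sigma x) = cl x.
Proof. by apply: cl_origin; apply: origin_sigma. Qed.

Let cl_a x : `|cl (alpha x) - cl x| = 1 := lq_label G x.

Let cl_p_dist x : `|cl (phi x) - cl x| = 1 := L_p_dist lq_sp cl_sigma cl_a x.

Local Notation down := (is_down (@alpha q) cl).

Lemma linkedE x y :
  linked x y = (cl (phi (phi (phi x))) == cl x - 1) && (y == partner (@phi q) cl x).
Proof. exact: (face_linkP p4 cl_p_dist x y). Qed.

Lemma linked_sym x y : linked x y = linked y x.
Proof. by apply/existsP/existsP => -[e]; rewrite orbC; exists e. Qed.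

Lemma markedE x : marked x = down (sigma x).
Proof.
rewrite /is_down (s_a lq_sp p4) a_inv -(s_a lq_sp p4) cl_sigma.
apply/existsP/idP => [[y]|h]; first by rewrite linkedE => /andP[].
by exists (partner (@phi q) cl x); rewrite linkedE h eqxx.
Qed.

(** The added edge leaves between [val c] and [sigma (val c)], so this is the first half-edge of the
    quadrangulation in the corner of the new map incident to [c]. *)
Definition down_half c : q := sigma (val c).

Lemma down_half_inj : injective down_half.
Proof. by move=> c z /s_inj/val_inj. Qed.

Lemma down_half_down c : down (down_half c).
Proof. by rewrite -markedE; apply: valP. Qed.

Lemma down_half_surj x : down x -> exists c, down_half c = x.
Proof.
move=> d; have mx : marked (finv sigma x) by rewrite markedE f_finv.
by exists (Sub (finv sigma x) mx); rewrite /down_half SubK f_finv.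
Qed.

Lemma first_marked c (n := first_hit (@sigma q) (@marked k t) (val c)) :
  [/\ (0 < n)%N, marked (iter n sigma (val c))
    & forall i, (0 < i < n)%N -> ~~ down (iter i sigma (down_half c))].
Proof.
have mc : marked (iter (order sigma (val c)) sigma (val c)).
  by rewrite iter_order //; apply: valP.
have [/andP[n0 _] mn hn] := first_hit_spec (order_gt0 _ _) mc.
by split=> // i /hn; rewrite markedE -iterS iterSr.
Qed.

Lemma down_half_S c : exists2 n,
  (0 < n)%N && (down_half (sigma c) == iter n sigma (down_half c))
  & forall i, (0 < i < n)%N -> ~~ down (iter i sigma (down_half c)).
Proof.
have [n0 mn hn] := first_marked c.
exists (first_hit (@sigma q) (@marked k t) (val c)) => //; rewrite n0 /=.
by rewrite /down_half /= /new_sigma insubdK // -iterS iterSr.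
Qed.

Lemma sectorP c x : reflect (in_sector sigma (@alpha q) cl down_half c x) (x \in sector c).
Proof.
have [n0 mn hn] := first_marked c.
apply: (iffP trajectP) => [[i lt ->]|[i -> h]].
  by exists i => // j /andP[j0 le]; apply: hn; rewrite j0 (leq_ltn_trans le).
exists i => //; rewrite ltnNge; apply/negP => le.
have := h (first_hit (@sigma q) (@marked k t) (val c)); rewrite n0 le => /(_ isT).
by rewrite /down_half -iterSr iterS -markedE mn.
Qed.

Lemma linked_alpha c : linked (val c) (val (alpha c)).
Proof.
rewrite /= /new_alpha; case: pickP => [//|h].
have /existsP[y ly] := valP c; have my : marked y.
  by apply/existsP; exists (val c); rewrite linked_sym.
by have := h (Sub y my); rewrite SubK ly.
Qed.

Lemma new_alpha_inv : involutive (@alpha M).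
Proof.
move=> c; apply: val_inj; have := linked_alpha c; have := linked_alpha (alpha c).
by rewrite linkedE (linked_sym (val c)) linkedE => /andP[_ /eqP->] /andP[_ /eqP->].
Qed.

Lemma partner_val c : val (alpha c) = partner (@phi q) cl (val c).
Proof. by have := linked_alpha c; rewrite linkedE => /andP[_ /eqP]. Qed.

Lemma up_halfE c : up (@alpha q) down_half c = phi (phi (phi (val c))).
Proof. by rewrite /up /down_half (s_a lq_sp p4) a_inv. Qed.

Lemma up_half_A c (u := up (@alpha q) down_half c) :
  up (@alpha q) down_half (alpha c) \in [:: phi u; phi (phi u); phi (phi (phi u))].
Proof.
rewrite /u !up_halfE partner_val; exact: partner_mem.
Qed.

Lemma new_alpha_neq c : alpha c != c.
Proof.
rewrite -(inj_eq val_inj) partner_val /partner; have d0 := cl_p_dist (val c).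
have d2 := cl_p_dist (phi (phi (val c))); have [_ n2] := lq_phi4 (val c).
have d3 := cl_p_dist (phi (phi (phi (val c)))); rewrite p4 in d3.
case: ifP => _; [|case: ifP => _]; apply/eqP => // E.
  by rewrite E subrr in d0.
by rewrite E subrr in d3.
Qed.

Lemma new_sigma_inj : injective (@sigma M).
Proof. exact: (S_inj s_inj down_half_inj down_half_down down_half_S). Qed.

Lemma new_SP c : sigma (P c) = alpha c.
Proof. exact: (sigma_phi new_sigma_inj new_alpha_inv). Qed.

Lemma new_sigma_unique c z n : (0 < n)%N -> iter n sigma (down_half c) = down_half z ->
  (forall i, (0 < i < n)%N -> ~~ down (iter i sigma (down_half c))) -> sigma c = z.
Proof. exact: (S_unique down_half_inj down_half_down down_half_S). Qed.

Lemma new_alpha_unique c z (u := up (@alpha q) down_half) :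
  u z \in [:: phi (u c); phi (phi (u c)); phi (phi (phi (u c)))] -> alpha c = z.
Proof.
exact: (up_A_unique a_inv lq_sp p4 cl_sigma cl_a down_half_inj down_half_down up_half_A).
Qed.

End LabelledQuadrangulation.

Lemma min_intP (s : seq int) : s != [::] ->
  min_int s \in s /\ forall z, z \in s -> min_int s <= z.
Proof.
case: s => // a s _; rewrite /min_int /=; move: (a :: s) (mem_head a s) => {}s ain.
suff [h1 h2] : (\big[Order.min/a]_(z <- s) z = a \/ \big[Order.min/a]_(z <- s) z \in s) /\
    forall z, z \in s -> \big[Order.min/a]_(z <- s) z <= z.
  by split=> //; case: h1 => [->|].
elim: s {ain} => [|b s [IH1 IH2]]; first by rewrite big_nil; split; first by left.
rewrite big_cons; split.
  case: (leP b (\big[Order.min/a]_(z <- s) z)) => _; first by right; rewrite mem_head.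
  by case: IH1 => [->|h]; [left | right; rewrite inE h orbT].
move=> z; rewrite inE ge_min => /orP[/eqP->|/IH2->]; first by rewrite lexx.
by rewrite orbT.
Qed.

Lemma min_int_eq (s : seq int) z : z \in s -> (forall y, y \in s -> z <= y) ->
  min_int s = z.
Proof.
move=> zs hz; have [|h1 h2] := @min_intP s; first by case: s zs {hz}.
by apply/eqP; rewrite eq_le h2 ?hz.
Qed.

Lemma card_edges (m : premap) : involutive (@alpha m) -> (forall e : m, alpha e != e) ->
  (#|edges m| * 2 = #|m|)%N.
Proof.
move=> ai an; apply: card_orbits; first exact: inv_inj.
move=> x; rewrite card_orbit_set.
rewrite (@order_cycle _ _ [:: x; alpha x]) ?inE ?eqxx //=; first by rewrite ai !eqxx.
by rewrite inE eq_sym an.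
Qed.

(** * Faces, successors and Euler counts of the new map *)

Section Psi.
Variables (k : nat) (t : unrootedQ k).
Hypothesis G : labelled_quadrangulation t.
Local Notation q := (qmap t).
Local Notation M := (new_map t).
Local Notation cl := (@corner_label k t).
Local Notation P := (@phi M).
Local Notation dn := (@down_half k t).
Local Notation u := (up (@alpha q) dn).
Local Notation down := (is_down (@alpha q) cl).
Local Notation in_sector := (in_sector sigma (@alpha q) cl dn).
Local Notation around := (around_source (@sigma q) (@alpha q) cl).
Local Notation lm := (fun c : M => cl (dn c)).
Implicit Types (x y : q) (c z : M).

Let s_inj := lq_sigma G.
Let a_inv := lq_alpha G.
Let sp := lq_sp G.
Let p4 x := (lq_phi4 G x).1.
Let L_s : forall x, cl (sigma x) = cl x := @cl_sigma k t G.
Let L_a := lq_label G.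
Let dn_inj : injective dn := @down_half_inj k t G.
Let dn_down := down_half_down G.
Let dn_surj := @down_half_surj k t G.
Let dn_S := down_half_S G.
Let up_A := up_half_A G.
Let A_inv := new_alpha_inv G.
Let A_neq := new_alpha_neq G.
Let SP := new_SP G.
Let faceE := fconnect_P s_inj a_inv sp p4 L_s L_a dn_inj dn_down dn_surj dn_S up_A A_inv SP.
Let face_min :=
  source_face_min s_inj a_inv sp p4 L_s L_a dn_inj dn_down dn_surj dn_S up_A SP.
Let hit_sector :=
  iter_P_sector s_inj a_inv sp p4 L_s L_a dn_inj dn_down dn_surj dn_S up_A SP.

Lemma around_sourceP x : (exists i, origin x = qsource t i) <-> around x.
Proof.
rewrite (lq_source G x); split=> [h i|h y].
  rewrite /is_down h ?inE ?fconnect_iter //; lia.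
rewrite inE => /iter_findex <-; have := h (findex sigma x y).
rewrite /is_down; have := L_a (iter (findex sigma x y) sigma x); lia.
Qed.

Lemma cl_val c : cl (val c) = cl (dn c).
Proof. by rewrite /down_half cl_sigma. Qed.

(** A half-edge leading to a source is decreasing, and [dn c] is the only decreasing one in the
    sector. *)
Lemma new_face_witness i c :
  has (fun f => target f == qsource t i) (sector c) = (origin (u c) == qsource t i).
Proof.
apply/hasP/idP => [[f /sectorP-/(_ G) fs tf]|E]; last first.
  exists (dn c) => //; apply/sectorP => //; exact: sector_self.
suff d : down f by move: tf; rewrite (sector_down fs d).
have /around_sourceP/(_ 0%N) : exists i, origin (alpha f) = qsource t i.
  by exists i; apply/eqP.
by rewrite /= is_down_a ?negbK //; apply: L_a.
Qed.

Lemma in_new_face i c :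
  (c \in new_face t i) = [exists z : M, fconnect P c z && (origin (u z) == qsource t i)].
Proof. by rewrite inE; apply: eq_existsb => z; rewrite new_face_witness. Qed.

Lemma source_corner i : exists c, origin (u c) = qsource t i.
Proof.
have /imsetP[x _ Ex] := lq_vertex G i.
have /around_sourceP/(_ 0%N) ax : exists i, origin x = qsource t i by exists i.
by have [c uc] := up_surj a_inv L_a dn_surj ax; exists c; rewrite uc.
Qed.

Lemma new_face_orbit i c : origin (u c) = qsource t i -> new_face t i = orbit_set P c.
Proof.
move=> Ec; have ac : around (u c) by apply/around_sourceP; exists i.
have P_sym := fconnect_sym (P_inj A_inv SP).
apply/setP => e; rewrite in_new_face mem_orbit_set P_sym.
apply/existsP/idP => [[z /andP[ez /eqP Ez]]|ce]; last by exists c; rewrite ce Ec eqxx.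
apply: connect_trans ez _; rewrite P_sym faceE //; last first.
  by apply/around_sourceP; exists i.
by rewrite -(orbit_set_eq s_inj) -/(origin _) Ec -Ez.
Qed.

Lemma new_face_inj : injective (@new_face k t).
Proof.
move=> i j E; have [c Ec] := source_corner i; have [z Ez] := source_corner j.
have : fconnect P c z.
  by rewrite -mem_orbit_set -(new_face_orbit Ec) E (new_face_orbit Ez) orbit_set_refl.
rewrite faceE; try by apply/around_sourceP; eexists; eassumption.
rewrite -(orbit_set_eq s_inj) => /eqP E'; apply: (lq_inj G).
by rewrite -Ec -Ez; exact: E'.
Qed.

Lemma new_faces : [set new_face t i | i : 'I_k] = faces M.
Proof.
apply/setP => f; apply/imsetP/imsetP => [[i _ ->]|[c _ ->]].
  by have [c Ec] := source_corner i; exists c => //; rewrite (new_face_orbit Ec).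
have [n ac] :=
  face_has_source s_inj a_inv sp p4 L_s L_a dn_inj dn_down dn_surj dn_S up_A SP c.
have /around_sourceP[i Ei] := ac; exists i => //.
rewrite (new_face_orbit Ei); apply/esym/orbit_set_iter; exact: (P_inj A_inv SP).
Qed.

Lemma source_labelE i c : origin (u c) = qsource t i ->
  source_label (Psi_unrooted t) i = cl (dn c) - 1.
Proof.
move=> Ec; have ac : around (u c) by apply/around_sourceP; exists i.
rewrite -[source_label _ _]/(min_int [seq cl (val e) | e : M <- enum (new_face t i)] - 1).
rewrite (new_face_orbit Ec); congr (_ - 1).
apply: min_int_eq => [|y].
  apply/mapP; exists c; last by rewrite cl_val.
  by rewrite mem_enum orbit_set_refl.
case/mapP => z; rewrite mem_enum mem_orbit_set => cz ->; rewrite cl_val.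
by have [] := face_min (findex P c z) ac; rewrite iter_findex.
Qed.

Lemma successor_source i c : origin (u c) = qsource t i ->
  successor (u := Psi_unrooted t) c = inl i.
Proof.
move=> Ec; rewrite /successor; case: pickP => [j /andP[cj' _]|h]; last first.
  have ci : c \in new_face t i by rewrite (new_face_orbit Ec) orbit_set_refl.
  have /negP[] := negbT (h i); apply/andP; split; first exact: ci.
  by rewrite (source_labelE Ec) subrK /= cl_val.
have {cj'} cj : c \in new_face t j := cj'.
congr inl; apply: new_face_inj; rewrite (new_face_orbit Ec).
have [z Ez] := source_corner j; move: cj; rewrite (new_face_orbit Ez).
by move/(orbit_set_mem (P_inj A_inv SP)).
Qed.

(** By [iter_P_sector] the first label one below that of [c] along the face occurs at [z]. The
    source branch is excluded because a corner of minimal label has its edge leading to a source,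
    around which nothing decreases. *)
Lemma successor_corner c z : in_sector z (u c) ->
  successor (u := Psi_unrooted t) c = inr z.
Proof.
move=> sz; rewrite /successor; case: pickP => [i /andP[ci' /eqP li]|_].
  have {ci'} ci : c \in new_face t i := ci'.
  have [z' Ez] := source_corner i; have az : around (u z') by apply/around_sourceP; exists i.
  rewrite (new_face_orbit Ez) mem_orbit_set in ci.
  move: li; rewrite (source_labelE Ez) subrK /= cl_val => El; have Ec := iter_findex ci.
  have [_] := face_min (findex P z' c) az.
  rewrite Ec => /(_ El) zc.
  have /(_ (findex sigma (u z') (dn z))) := az.
  rewrite iter_findex; first by rewrite dn_down.
  apply: connect_trans zc _; rewrite fconnect_sym //; exact: sector_orbit sz.
have [j /andP[j0 /eqP Ej] hj] := hit_sector sz.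
pose low (e : M) := cl (val e) == cl (val c) - 1.
rewrite -[first_hit _ _ _]/(first_hit P low c) (@first_hit_eq _ P low c j) //.
- by rewrite Ej.
- by rewrite /low Ej !cl_val -(sector_L L_s sz) (L_up dn_down).
by move=> i /hj; rewrite /low !cl_val; lia.
Qed.

Lemma drawnE c x : drawn c x = (x == dn c).
Proof.
have corner_or := around_source_or_sector s_inj dn_down dn_surj dn_S c.
apply/andP/eqP => [[/sectorP-/(_ G) sx hs]|->]; last first.
  split; first by apply/sectorP => //; apply: sector_self.
  case: corner_or => [/around_sourceP[i Ei]|[z sz]].
    by rewrite (successor_source Ei); apply/eqP.
  by rewrite (successor_corner sz); apply/sectorP.
apply: (sector_down sx); apply/negPn/negP => nd; move: hs.
case: corner_or => [/around_sourceP[i Ei]|[z sz]].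
  rewrite (successor_source Ei) => /eqP E.
  have /around_sourceP/(_ 0%N) : exists i, origin (alpha x) = qsource t i by exists i.
  by rewrite /= is_down_a ?nd //; apply: L_a.
rewrite (successor_corner sz) => /sectorP-/(_ G) /(sector_L L_s).
have := sector_L L_s sz; rewrite (L_up dn_down) => <-.
have := sector_L L_s sx; move: nd; rewrite /is_down; have := L_a x; lia.
Qed.

(** A vertex of [q] either has a decreasing half-edge, and then is a vertex of the new map, or is a
    source, and there is one source per face. The other two equalities count half-edges. Together
    they make the two Euler relations equivalent for the same genus. *)
Lemma psi_counts : [/\ #|vertices q| = #|vertices M| + #|faces M|,
  #|faces q| = #|edges M| & #|edges q| = #|edges M| * 2]%N.
Proof.
have eM : (#|edges M| * 2 = #|M|)%N by apply: card_edges.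
have eq_ : (#|edges q| * 2 = #|q|)%N.
  apply: card_edges => // x; apply/eqP => E; have := L_a x; rewrite E; lia.
have fq : (#|faces q| * 4 = #|q|)%N.
  apply: card_orbits; first exact: (phi_inj s_inj a_inv).
  by move=> x; apply: (lq_quad G); apply: imset_f.
have qM : (#|q| = #|M| * 2)%N.
  have /bij_eq_card <- := drawn_edge_bij a_inv L_a dn_inj dn_down dn_surj.
  by rewrite card_prod card_bool.
split; try by lia.
have vM : #|vertices M| = #|[set origin (dn c) | c in [set: M]]|.
  rewrite -(@card_imset_same_fibers _ _ _ (@origin M)); last first.
    move=> c z _ _; rewrite /origin !orbit_set_eq //; last exact: (new_sigma_inj G).
    exact: (fconnect_S s_inj dn_inj dn_down dn_S).
  by apply: eq_card => v; apply/imsetP/imsetP => -[c _ ->]; exists c.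
have fM : #|faces M| = #|[set qsource t i | i : 'I_k]|.
  rewrite -new_faces !card_imset //; [exact: (lq_inj G) | exact: new_face_inj].
rewrite vM fM -cardsUI; set I := _ :&: _.
have -> : I = set0.
  apply/setP => v; rewrite !inE; apply/negP => /andP[/imsetP[c _ ->] /imsetP[i _ E]].
  have /around_sourceP/(_ 0%N) : exists i, origin (dn c) = qsource t i by exists i.
  by rewrite /= dn_down.
rewrite cards0 addn0; apply: eq_card => v; rewrite !inE; apply/imsetP/orP.
  case=> x _ ->; case: (boolP [exists y, fconnect sigma x y && down y]).
    case/existsP=> y /andP[xy /dn_surj[c Ec]]; left; apply/imsetP; exists c => //.
    by apply/eqP; rewrite /origin orbit_set_eq // Ec.
  move/existsPn => h; right.
  have /around_sourceP[i Ei] : around x.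
    by move=> i; have := h (iter i sigma x); rewrite fconnect_iter.
  by apply/imsetP; exists i.
case=> [/imsetP[c _ ->]|/imsetP[i _ ->]]; first by exists (dn c).
by have /imsetP[x _ ->] := lq_vertex G i; exists x.
Qed.

End Psi.

(** * Labels and delay vectors *)

Lemma dist_sym (m : premap) (u v : {set m}) :
  injective (@sigma m) -> involutive (@alpha m) ->
  (forall e e' : m, connect (fun a b => (sigma a == b) || (alpha a == b)) e e') ->
  u \in vertices m -> v \in vertices m -> dist u v = dist v u.
Proof.
move=> sinj ainv conn.
suff le x y : x \in vertices m -> y \in vertices m -> (dist x y <= dist y x)%N.
  by move=> uV vV; apply/eqP; rewrite eqn_leq !le.
move=> xV yV; have [p [pp lp <-]] := @dist_path m sinj conn y x yV xV.
have -> : size p = size (rev (belast y p)) by rewrite size_rev size_belast.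
apply: dist_le.
  by rewrite -lp rev_path (eq_path (e' := @adjacent m)) // => a b; apply: adjacent_sym.
by case: p {pp} lp => //= a p _; rewrite rev_cons last_rcons.
Qed.

Lemma qlabel_spec k (t : unrootedQ k) v : (0 < k)%N ->
  (exists i, qlabel v = qdelay t i + (dist v (qsource t i))%:Z) /\
  forall i, qlabel v <= qdelay t i + (dist v (qsource t i))%:Z.
Proof.
case: k t v => // k t v _; rewrite /qlabel.
have [|/mapP[i _ Ei] h] :=
  @min_intP [seq qdelay t i + (dist v (qsource t i))%:Z | i <- enum 'I_k.+1].
  by rewrite -size_eq0 size_map size_enum_ord.
split; first by exists i.
by move=> j; apply: h; apply: map_f; rewrite mem_enum.
Qed.

Section LabelUniqueness.
Variables (k : nat) (t : unrootedQ k) (lab : qmap t -> int).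
Hypothesis s_inj : injective (@sigma (qmap t)).
Hypothesis a_inv : involutive (@alpha (qmap t)).
Hypothesis conn : forall e e' : qmap t,
  connect (fun a b => (sigma a == b) || (alpha a == b)) e e'.
Hypothesis lab_sigma : forall e, lab (sigma e) = lab e.
Hypothesis lab_alpha : forall e, `|lab (alpha e) - lab e| = 1.
Hypothesis source_vertex : forall i, qsource t i \in vertices (qmap t).
Hypothesis source_lab : forall i e, origin e = qsource t i -> lab e = qdelay t i.
Hypothesis local_min : forall e,
  (forall e', e' \in origin e -> lab (alpha e') = lab e' + 1) ->
  exists i, origin e = qsource t i.

Lemma lab_origin e e' : origin e = origin e' -> lab e = lab e'.
Proof.
move/eqP; rewrite orbit_set_eq // => /iter_findex <-.
by elim: (findex _ _ _) => //= n ->; rewrite lab_sigma.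
Qed.

(** Steps of size 1 bound [lab] above by every delay plus distance. Conversely, decreasing steps
    lead from any vertex to a local minimum, hence to a source, in as many steps as the label drops.
    Labelings obtained otherwise are thus recognised without computing distances. *)
Lemma corner_label_unique e : corner_label e = lab e.
Proof.
pose L (v : {set qmap t}) := if [pick x in v] is Some x then lab x else 0.
have LE x : L (origin x) = lab x.
  rewrite /L; case: pickP => [y yx|/(_ x)]; last by rewrite origin_refl.
  by apply: lab_origin; apply: origin_mem yx.
have Llip x : `|L (origin x) - L (target x)| <= 1.
  by rewrite /target !LE; have := lab_alpha x; lia.
have LS i : L (qsource t i) = qdelay t i.
  by have /imsetP[x _ E] := source_vertex i; rewrite E LE (source_lab (esym E)).
have up x : exists i, qdelay t i + (dist (origin x) (qsource t i))%:Z <= lab x.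
  pose B : int := (\max_y `|lab y|%N)%:Z.
  have hB y : `|lab y| <= B by have := @leq_bigmax _ (fun c => `|lab c|%N) y; lia.
  have : lab x + B < (absz (lab x + B)).+1%:Z by lia.
  move: (absz (lab x + B)).+1 => n; elim: n x => [|n IH] x lt.
    by have := hB x; lia.
  case: (boolP [forall y in origin x, lab (alpha y) == lab y + 1]) => h.
    have [i Ei] : exists i, origin x = qsource t i.
      by apply: local_min => y yx; apply/eqP; move/forall_inP: h; apply.
    by exists i; rewrite (source_lab Ei) Ei dist_refl; lia.
  move: h; rewrite negb_forall_in => /exists_inP[y yx ny].
  have lyx : lab y = lab x by apply: lab_origin; apply: origin_mem.
  have ly : lab (alpha y) = lab x - 1 by have := lab_alpha y; lia.
  have [|i hi] := IH (alpha y); first by lia.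
  exists i; have := dist_adjacent s_inj conn y (source_vertex i).
  rewrite /target (origin_mem s_inj yx); lia.
have [i0 h0] := up e.
have k0 : (0 < k)%N by apply: leq_ltn_trans (ltn_ord i0).
have [[i Ei] hmin] := qlabel_spec (origin e) k0.
apply/eqP; rewrite eq_le; apply/andP; split; first exact: le_trans (hmin i0) h0.
rewrite /corner_label Ei -(LE e) -LS.
have := dist_lipschitz s_inj conn Llip (origin_in_vertices e) (source_vertex i); lia.
Qed.

End LabelUniqueness.

(** Labels of neighbours differ by at most 1, and by an odd number: bipartiteness gives the parity
    of each distance, and the evenness condition makes the candidates coming from different sources
    compatible. The strict inequality makes each source attain its own delay and be a local
    minimum. *)
Lemma in_Q_labelled g k (t : unrootedQ k) : (0 < k)%N -> in_Q g t ->
  labelled_quadrangulation t.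
Proof.
move=> k0 [[[s_inj [a_inv _] _ conn _] quad] [c hc] xV hlt heven].
have spec (v : {set qmap t}) := qlabel_spec v k0.
have adj e i : (dist (origin e) (qsource t i) <= (dist (target e) (qsource t i)).+1)%N.
  exact: dist_adjacent.
have adj' e i : (dist (target e) (qsource t i) <= (dist (origin e) (qsource t i)).+1)%N.
  by have := adj (alpha e) i; rewrite /target a_inv.
(* The 2-colouring is turned into an integer labeling so that [dist_parity] applies. *)
pose L (v : {set qmap t}) : int := if c v then 1 else 0.
have hL e : `|L (origin e) - L (target e)| = 1.
  by rewrite /L; have := hc e; case: (c _); case: (c _).
have par u v := dist_parity s_inj conn hL (u := u) (v := v).
have oV := @origin_in_vertices (qmap t).
have lbl (e : qmap t) : `|corner_label (alpha e) - corner_label e| = 1.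
  rewrite /corner_label -/(target e).
  have [[i Ei] hi] := spec (origin e); have [[j Ej] hj] := spec (target e).
  have := hi j; have := hj i; have := adj e j; have := adj' e i.
  have := par _ _ (oV e) (xV i); have := par _ _ (oV (alpha e)) (xV j).
  have := par _ _ (xV i) (xV j); have [_] := heven i j; have := hL e.
  rewrite -/(target e) Ei Ej; lia.
have src i : qlabel (qsource t i) = qdelay t i.
  have [[j Ej] hj] := spec (qsource t i).
  have := hj i; rewrite dist_refl => le; apply/eqP; rewrite eq_le.
  case: (eqVneq i j) => [E|N]; first by rewrite Ej -E dist_refl; lia.
  by rewrite Ej; have := hlt i j N; rewrite Ej in le; lia.
split=> //.
- move=> e; split=> [[i Ei] e' e'e|h].
    have oe : origin e' = qsource t i by rewrite (origin_mem s_inj e'e).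
    have le : corner_label e' = qdelay t i by rewrite /corner_label oe src.
    have := lbl e'; rewrite le; suff : qdelay t i <= corner_label (alpha e') by lia.
    rewrite /corner_label -/(target e'); have [[j ->] _] := spec (target e').
    have := adj e' j; rewrite oe; case: (eqVneq i j) => [->|/hlt]; first by rewrite dist_refl; lia.
    lia.
  have [[i Ei] hi] := spec (origin e).
  exists i; apply/eqP; apply/negPn/negP => /eqP ne.
  have [e' oe' le'] := dist_step s_inj conn (oV e) (xV i) ne.
  have e'e : e' \in origin e by rewrite -oe' origin_refl.
  have := h _ e'e; rewrite /corner_label -/(target e') oe' Ei.
  have [_ /(_ i)] := spec (target e'); lia.
- move=> i j E; apply/eqP; apply/negPn/negP => /hlt.
  rewrite E dist_refl; lia.
- by move=> i e Ei; rewrite /corner_label Ei src.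
Qed.

(** The parity of the label is a proper colouring. For strictness, the first step of a shortest path
    from one source to another goes up, and the rest changes the label by at most its length. *)
Lemma labelled_in_Q g k (t : unrootedQ k) : labelled_quadrangulation t ->
  map_of_genus (qmap t) g -> in_Q g t.
Proof.
move=> G mg; have [s_inj [a_inv _] _ conn _] := mg.
have oV := @origin_in_vertices (qmap t); have xV := lq_vertex G.
have src i : qlabel (qsource t i) = qdelay t i.
  by have /imsetP[x _ E] := xV i; rewrite E; apply: (lq_delay G).
have lbl (e : qmap t) : `|qlabel (origin e) - qlabel (target e)| = 1.
  by have := lq_label G e; rewrite /corner_label -/(target e); lia.
have lip (e : qmap t) : `|qlabel (origin e) - qlabel (target e)| <= 1 by rewrite lbl.
have strict i j : i != j -> qdelay t i - qdelay t j < (dist (qsource t i) (qsource t j))%:Z.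
  move=> N; have [|e oe le] := dist_step s_inj conn (xV i) (xV j).
    by move=> /(lq_inj G)/eqP; rewrite (negPf N).
  have /(lq_source G) h : exists i, origin e = qsource t i by exists i.
  have := h e (origin_refl e); rewrite /corner_label -/(target e) oe src.
  have := dist_lipschitz s_inj conn lip (oV (alpha e)) (xV j); rewrite src -/(target e); lia.
split=> //.
- split=> //; exact: (lq_quad G).
- exists (fun v => odd `|qlabel (t := t) v|%N) => e; have := lbl e; lia.
- move=> i j N; have := strict _ _ N; have := strict j i.
  rewrite eq_sym N (dist_sym s_inj a_inv conn (xV j)) // => /(_ isT); lia.
move=> i j; split; last by have := dist_parity s_inj conn lbl (xV i) (xV j); rewrite !src.
case: (eqVneq i j) => [->|N]; first by lia.
have := strict j i; rewrite eq_sym N (dist_sym s_inj a_inv conn (xV j)) // => /(_ isT); lia.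
Qed.

(** * Isomorphisms and naturality *)

Section Isomorphisms.
Variables (m m' : premap) (h : m -> m').
Hypothesis iso_h : map_iso h.

Lemma iso_inj : injective h.
Proof. by have [/bij_inj] := iso_h. Qed.

Lemma iso_orbit (f : m -> m) (f' : m' -> m') : (forall e, h (f e) = f' (h e)) ->
  forall e, h @: orbit_set f e = orbit_set f' (h e).
Proof.
move=> hf e; have hit n : h (iter n f e) = iter n f' (h e).
  by elim: n => //= n <-.
apply/setP => y; rewrite mem_orbit_set; apply/imsetP/idP => [[x]|/iter_findex <-].
  by rewrite mem_orbit_set => /iter_findex <- ->; rewrite hit fconnect_iter.
by exists (iter (findex f' (h e) y) f e); rewrite ?mem_orbit_set ?fconnect_iter ?hit.
Qed.

Lemma iso_card_orbits (f : m -> m) (f' : m' -> m') : (forall e, h (f e) = f' (h e)) ->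
  #|[set orbit_set f' e | e : m']| = #|[set orbit_set f e | e : m]|.
Proof.
move=> hf; have [[g hK gK] _ _] := iso_h.
rewrite -(card_imset [set orbit_set f e | e : m] (imset_inj iso_inj)).
apply: eq_card => v; apply/imsetP/imsetP => [[y _ ->]|[_ /imsetP[x _ ->] ->]].
  by exists (orbit_set f (g y)); rewrite ?imset_f // (iso_orbit hf) gK.
by exists (h x); rewrite ?(iso_orbit hf).
Qed.

Lemma iso_origin e : h @: origin e = origin (h e).
Proof. by have [_ hs _] := iso_h; apply: iso_orbit. Qed.

Section Phi.
Hypotheses (si : injective (@sigma m)) (si' : injective (@sigma m')).
Hypotheses (ai : involutive (@alpha m)) (ai' : involutive (@alpha m')).

Lemma iso_phi e : h (phi e) = phi (h e).
Proof.
have [_ hs ha] := iso_h.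
by apply: si'; rewrite -hs !sigma_phi.
Qed.

Lemma iso_euler : [/\ #|vertices m'| = #|vertices m|, #|edges m'| = #|edges m|
  & #|faces m'| = #|faces m|].
Proof.
by have [_ hs ha] := iso_h; split; apply: iso_card_orbits => //; apply: iso_phi.
Qed.

End Phi.
End Isomorphisms.

Lemma map_iso_comp (m1 m2 m3 : premap) (f : m1 -> m2) (g : m2 -> m3) :
  map_iso f -> map_iso g -> map_iso (g \o f).
Proof.
move=> [fb fs fa] [gb gs ga]; split; first exact: bij_comp.
  by move=> e /=; rewrite fs gs.
by move=> e /=; rewrite fa ga.
Qed.

Lemma map_iso_inv (m m' : premap) (h : m -> m') g :
  map_iso h -> cancel h g -> cancel g h -> map_iso g.
Proof.
move=> [_ hs ha] hK gK; split; first by exists h.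
  by move=> e; apply: (can_inj hK); rewrite hs !gK.
by move=> e; apply: (can_inj hK); rewrite ha !gK.
Qed.

Lemma iso_unrootedQ_comp k (t1 t2 t3 : unrootedQ k) f g :
  @iso_unrootedQ k t1 t2 f -> @iso_unrootedQ k t2 t3 g -> iso_unrootedQ (g \o f).
Proof.
move=> [fi fx [c fc]] [gi gx [d gd]]; split; first exact: map_iso_comp.
  by move=> i; rewrite imset_comp fx gx.
by exists (c + d) => i; rewrite gd fc addrA.
Qed.

Lemma iso_unrootedQ_inv k (t t' : unrootedQ k) h : @iso_unrootedQ k t t' h ->
  exists g, [/\ cancel h g, cancel g h & @iso_unrootedQ k t' t g].
Proof.
move=> [hi hx [c hc]]; have [[g hK gK] _ _] := hi.
exists g; split=> //; split; first exact: map_iso_inv hi hK gK.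
  move=> i; rewrite -hx -imset_comp; under eq_imset => y do rewrite /= hK.
  by rewrite imset_id.
by exists (- c) => i; rewrite hc addrK.
Qed.

Lemma iso_unrootedLM_comp k (t1 t2 t3 : unrootedLM k) f g :
  @iso_unrootedLM k t1 t2 f -> @iso_unrootedLM k t2 t3 g -> iso_unrootedLM (g \o f).
Proof.
move=> [fi fx [c fc]] [gi gx [d gd]]; split; first exact: map_iso_comp.
  by move=> i; rewrite imset_comp fx gx.
by exists (c + d) => i; rewrite /= gd fc addrA.
Qed.

Section PsiNatural.
Variables (k : nat) (t t' : unrootedQ k) (h : qmap t -> qmap t').
Hypothesis iso_h : iso_unrootedQ h.
Hypothesis G : labelled_quadrangulation t.
Hypothesis G' : labelled_quadrangulation t'.
Hypothesis conn' : forall e e' : qmap t',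
  connect (fun a b => (sigma a == b) || (alpha a == b)) e e'.

(** Distances are not compared: the labeling transported from [t], shifted by [c], satisfies the
    conditions of [corner_label_unique] on [t']. *)
Lemma iso_corner_label : exists c : int, forall e : qmap t, corner_label (h e) = corner_label e + c.
Proof.
have [hi hx [c hc]] := iso_h; have [[g hK gK] hs ha] := hi.
exists c => e; rewrite -[e in RHS]hK.
apply: (@corner_label_unique k t' (fun y => corner_label (g y) + c)) => //.
- exact: (lq_sigma G').
- by move=> y; rewrite -[y]gK -hs !hK cl_sigma.
- by move=> y; rewrite -[y]gK -ha !hK; have := lq_label G (g y); lia.
- exact: (lq_vertex G').
- move=> i y Ey; rewrite hc; congr (_ + c); apply: (lq_delay G).
  by apply: (imset_inj (iso_inj hi)); rewrite (iso_origin hi) gK Ey hx.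
move=> y hy; have [|i Ei] := (lq_source G (g y)).2.
  move=> x xg; have := hy (h x); rewrite -ha !hK.
  rewrite -[y]gK -(iso_origin hi) imset_f // => /(_ isT); lia.
by exists i; rewrite -[y]gK -(iso_origin hi) Ei hx.
Qed.

Lemma iso_is_down e :
  is_down (@alpha (qmap t')) (@corner_label k t') (h e) =
  is_down (@alpha (qmap t)) (@corner_label k t) e.
Proof.
have [[_ _ ha] _ _] := iso_h; have [c hc] := iso_corner_label.
by rewrite /is_down -ha !hc; lia.
Qed.

Lemma Psi_natural : exists2 hm : new_map t -> new_map t',
  @iso_unrootedLM k (Psi_unrooted t) (Psi_unrooted t') hm
  & forall c, down_half (hm c) = h (down_half c).
Proof.
have [hi hx [c0 _]] := iso_h; have [_ hs ha] := hi; have [c hc] := iso_corner_label.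
have hmk (z : new_map t) : marked (h (val z)).
  by rewrite markedE // -hs iso_is_down -markedE //; apply: valP.
pose hm : new_map t -> new_map t' := fun z => Sub (h (val z)) (hmk z).
have hdn z : down_half (hm z) = h (down_half z) by rewrite /down_half /hm SubK hs.
have hup z : up (@alpha _) (@down_half k t') (hm z) = h (up (@alpha _) (@down_half k t) z).
  by rewrite /up hdn ha.
have hit n x : h (iter n sigma x) = iter n sigma (h x).
  by elim: n => //= n <-.
have hph := iso_phi hi (lq_sigma G) (lq_sigma G') (lq_alpha G) (lq_alpha G').
have hmb : bijective hm.
  apply: inj_card_bij.
    by move=> x y /(congr1 (@down_half k t')); rewrite !hdn => /(iso_inj hi)/(down_half_inj G).
  have [_ _ e1] := psi_counts G; have [_ _ e2] := psi_counts G'.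
  have [_ e3 _] := iso_euler hi (lq_sigma G) (lq_sigma G') (lq_alpha G) (lq_alpha G').
  have c1 := card_edges (new_alpha_inv G) (new_alpha_neq G).
  have c2 := card_edges (new_alpha_inv G') (new_alpha_neq G').
  by rewrite -[leqLHS]c2 -[leqRHS]c1 -e1 -e2 e3.
have hmi : map_iso hm.
  split=> // z.
    have [n /andP[n0 /eqP En] hn] := down_half_S G z.
    apply/esym/(new_sigma_unique G' n0); first by rewrite !hdn En hit.
    by move=> i /hn; rewrite hdn -hit iso_is_down.
  apply/esym/(new_alpha_unique G'); rewrite !hup -!hph.
  by rewrite !inE !(inj_eq (iso_inj hi)); have := up_half_A G z; rewrite /= !inE.
exists hm => //; split=> //.
  move=> i; have [z Ez] := source_corner G i.
  have Ez' : origin (up (@alpha _) (@down_half k t') (hm z)) = qsource t' i.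
    by rewrite hup -(iso_origin hi) Ez hx.
  have hphi := iso_phi hmi (new_sigma_inj G) (new_sigma_inj G')
    (new_alpha_inv G) (new_alpha_inv G').
  have := iso_orbit hphi z.
  by rewrite -(new_face_orbit G Ez) -(new_face_orbit G' Ez').
by exists c => z; exact: hc.
Qed.

End PsiNatural.

(** * The inverse construction *)

Lemma first_hit_iso (T T' : finType) (h : T -> T') f f' (R : pred T) (R' : pred T') x :
  bijective h -> (forall y, h (f y) = f' (h y)) -> (forall y, R' (h y) = R y) ->
  first_hit f' R' (h x) = first_hit f R x.
Proof.
move=> hb hf hR; rewrite /first_hit -(bij_eq_card hb) -hf.
have -> n y : traject f' (h y) n = map h (traject f y n).
  by elim: n y => //= n IH y; rewrite -hf IH.
by rewrite find_map; congr _.+1; apply: eq_find => y /=.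
Qed.

Lemma iter_first_hit_iso (T T' : finType) (h : T -> T') f f' (R : pred T) (R' : pred T') x :
  bijective h -> (forall y, h (f y) = f' (h y)) -> (forall y, R' (h y) = R y) ->
  iter (first_hit f' R' (h x)) f' (h x) = h (iter (first_hit f R x) f x).
Proof.
move=> hb hf hR; rewrite (first_hit_iso _ hb hf hR).
by elim: (first_hit _ _ _) => //= n ->.
Qed.

Lemma draw_sigma_iso (m m' : finType) (h : m -> m') S S' P P'
    (l : m -> int) (l' : m' -> int) (c : int) e b :
  injective P -> injective P' -> bijective h ->
  (forall y, h (S y) = S' (h y)) -> (forall y, h (P y) = P' (h y)) ->
  (forall y, l' (h y) = l y + c) ->
  draw_sigma S' P' l' (h e, b) = (h (draw_sigma S P l (e, b)).1, (draw_sigma S P l (e, b)).2).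
Proof.
move=> Pi Pi' hb hS hP hl; have hi := bij_inj hb.
have hQ y : h (finv P y) = finv P' (h y).
  by apply: (Pi'); rewrite -hP !f_finv.
have lowE y : next_low P' l' (h y) = h (next_low P l y).
  by apply: iter_first_hit_iso => // z; rewrite !hl lerD2r.
have backE y : next_low (finv P') l' (h y) = h (next_low (finv P) l y).
  by apply: iter_first_hit_iso => // z; rewrite !hl lerD2r.
case: b => /=.
  by rewrite backE -hP (inj_eq hi); case: ifP; rewrite ?hS.
by rewrite lowE !hl (inj_eq (addIr c)); case: ifP; rewrite ?hS.
Qed.

(** A source is a vertex, hence a set of half-edges: the reversals of the edges drawn from the
    corners of minimal label of its face. *)
Definition drawing k (u : unrootedLM k) : unrootedQ k :=
  @UnrootedQ k
    (@Premap (lmap u * bool)%type (draw_sigma (@sigma (lmap u)) (@phi (lmap u)) (@llabel k u))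
      (fun x => (x.1, ~~ x.2)))
    (fun i => [set (e, false) | e in [pred e in lface u i | llabel e == source_label u i + 1]])
    (source_label u).

Lemma order4 (T : finType) (f : T -> T) x : (forall y, f (f (f (f y))) = y) ->
  (forall y, f (f y) != y) -> order f x = 4%N.
Proof.
move=> f4 f2; have f1 y : f y != y by apply: contraNneq (f2 y) => E; rewrite !E.
have f3 y : f (f (f y)) != y by apply: contraNneq (f1 y) => E; rewrite -{1}E f4.
apply: (@order_cycle _ _ [:: x; f x; f (f x); f (f (f x))]); rewrite /= ?inE ?f4 ?eqxx //.
have nx y : [&& y != f y, y != f (f y) & y != f (f (f y))].
  by rewrite !(eq_sym y) f1 f2 f3.
rewrite !negb_or; have /and3P[-> -> ->] := nx x; have /and3P[-> -> _] := nx (f x).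
by have /and3P[-> _ _] := nx (f (f x)).
Qed.

Section Drawing.
Variables (g k : nat) (u : unrootedLM k).
Hypothesis H : in_LM g u.
Local Notation m := (lmap u).
Local Notation l := (@llabel k u).
Local Notation q := (qmap (drawing u)).
Local Notation P := (@phi m).
Implicit Types (e : m) (x y : q).

Let s_inj : injective (@sigma m).
Proof. by case: H => [[]]. Qed.
Let A_inv : involutive (@alpha m).
Proof. by case: H => [[_ []]]. Qed.
Let A_neq e : alpha e != e.
Proof. by case: H => [[_ []]]. Qed.
Let conn e e' : connect (fun a b => (sigma a == b) || (alpha a == b)) e e'.
Proof. by case: H => [[]]. Qed.
Let face_inj : injective (@lface k u).
Proof. by case: H. Qed.
Let faces_eq : [set lface u i | i : 'I_k] = faces m.
Proof. by case: H. Qed.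
Let l_S e : l (sigma e) = l e.
Proof. by case: H. Qed.
Let l_A e : `|l e - l (alpha e)| <= 1.
Proof. by case: H. Qed.
Let P_inj : injective P := phi_inj s_inj A_inv.
Let SP e : sigma (P e) = alpha e := sigma_phi s_inj A_inv e.

Lemma drawing_sigma_inj : injective (@sigma q).
Proof. exact: (draw_sigma_inj P_inj A_inv SP l_S l_A). Qed.

Lemma drawing_alpha_inv : involutive (@alpha q).
Proof. by move=> [e b]; rewrite /= negbK. Qed.

Lemma drawing_phi x : phi x = draw_phi (@alpha m) P l x.
Proof.
apply: drawing_sigma_inj; rewrite (sigma_phi drawing_sigma_inj drawing_alpha_inv).
exact/esym/(draw_sigma_invK P_inj A_inv SP l_S l_A).
Qed.

Lemma drawing_quad : quadrangulation q.
Proof.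
move=> f /imsetP[x _ ->]; rewrite card_orbit_set; apply: order4 => y.
  by rewrite !drawing_phi (draw_phi4 P_inj A_inv SP l_S l_A).
by rewrite !drawing_phi (draw_phi2_neq P_inj A_inv A_neq SP l_S l_A).
Qed.

Lemma drawing_connect x y :
  connect (fun a b => (sigma a == b) || (alpha a == b)) x y.
Proof. exact: (draw_connect P_inj A_inv SP l_S l_A conn). Qed.

Local Notation lab := (draw_label l).

Lemma drawing_lab_alpha x : `|lab (alpha x) - lab x| = 1.
Proof. by case: x => e []; rewrite /draw_label /=; lia. Qed.

Lemma face_corner i : exists2 e, lface u i = orbit_set P e &
  l e = source_label u i + 1 /\ forall n, l e <= l (iter n P e).
Proof.
have /imsetP[e0 _ E0] : lface u i \in faces m by rewrite -faces_eq imset_f.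
have [|h1 h2] := @min_intP [seq l e | e <- enum (lface u i)].
  have : e0 \in enum (lface u i) by rewrite mem_enum E0 orbit_set_refl.
  by case: (enum _).
case/mapP: h1 => e ei Ee; rewrite mem_enum E0 in ei.
exists e; first by rewrite E0 (orbit_set_mem P_inj ei).
split; first by rewrite /source_label Ee subrK.
move=> n; rewrite -Ee; apply: h2; apply: map_f; rewrite mem_enum E0.
by rewrite -(orbit_set_mem P_inj ei) mem_orbit_set fconnect_iter.
Qed.

Lemma drawing_source i e : lface u i = orbit_set P e -> l e = source_label u i + 1 ->
  (forall n, l e <= l (iter n P e)) -> qsource (drawing u) i = origin (m := q) (e, false).
Proof.
move=> Ei le hmin; apply/setP => y; rewrite [in RHS]mem_orbit_set.
apply/imsetP/idP => [[e']|/iter_findex <-].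
  rewrite !inE Ei mem_orbit_set => /andP[/iter_findex <- /eqP le'] ->.
  by apply: (min_connect _ P_inj); rewrite // le le'.
have [j -> lj] := min_orbit P_inj SP l_S l_A (findex (@sigma q) (e, false) y) hmin.
by exists (iter j P e); rewrite // !inE Ei mem_orbit_set fconnect_iter lj le eqxx.
Qed.

Lemma drawing_source_lab i x : origin x = qsource (drawing u) i -> lab x = source_label u i.
Proof.
move=> E; have : x \in qsource (drawing u) i by rewrite -E origin_refl.
by case/imsetP => e; rewrite !inE => /andP[_ /eqP le] ->; rewrite /draw_label /= le addrK.
Qed.

(** A vertex with an outgoing [(e, true)] has a lower neighbour. So a local minimum consists of
    arriving edges [(e, false)], and [nonmin_orbit] forces [e] to be minimal in its face. *)
Lemma drawing_local_min x : (exists i, origin x = qsource (drawing u) i) <->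
  (forall y, y \in origin x -> lab (alpha y) = lab y + 1).
Proof.
split=> [[i ->] y /imsetP[e _ ->]|h]; first by rewrite /draw_label /= subrK.
have [e Ex] : exists e, x = (e, false).
  have := h x (origin_refl x); case: x {h} => e [] /=; last by exists e.
  by rewrite /draw_label /=; lia.
have hmin n : l e <= l (iter n P e).
  rewrite leNgt; apply/negP => lt.
  have [i hi] := nonmin_orbit (@sigma m) P_inj (ex_intro _ n lt : nonmin P l e).
  have := h (iter i (@sigma q) x); rewrite mem_orbit_set fconnect_iter => /(_ isT).
  move: hi; rewrite Ex; case: (iter i _ _) => e' [] // _; rewrite /draw_label /=; lia.
have /imsetP[i _ Ei] : orbit_set P e \in [set lface u i | i : 'I_k].
  by rewrite faces_eq imset_f.
have [e' Ei' [le' hmin']] := face_corner i.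
exists i; rewrite Ex; apply/esym/drawing_source => //.
have e'e : e' \in orbit_set P e by rewrite Ei Ei' orbit_set_refl.
have ee' : e \in orbit_set P e' by rewrite -Ei' -Ei orbit_set_refl.
move: ee' e'e; rewrite !mem_orbit_set -le'.
move=> /iter_findex E1 /iter_findex E2; apply/eqP; rewrite eq_le.
have := hmin (findex P e e'); have := hmin' (findex P e' e).
by rewrite E1 E2 => -> ->.
Qed.

Lemma drawing_source_vertex i : qsource (drawing u) i \in vertices q.
Proof.
by have [e Ei [le hm]] := face_corner i; rewrite (drawing_source Ei le hm) origin_in_vertices.
Qed.

Lemma drawing_label x : corner_label x = lab x.
Proof.
apply: corner_label_unique.
- exact: drawing_sigma_inj.
- exact: drawing_connect.
- exact: (draw_label_sigma P_inj SP l_S l_A).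
- exact: drawing_lab_alpha.
- exact: drawing_source_vertex.
- exact: drawing_source_lab.
- by move=> e /drawing_local_min.
Qed.

Lemma drawing_labelled : labelled_quadrangulation (drawing u).
Proof.
split.
- exact: drawing_sigma_inj.
- exact: drawing_alpha_inv.
- exact: drawing_quad.
- by move=> x; rewrite !drawing_label; apply: drawing_lab_alpha.
- move=> x; rewrite drawing_local_min.
  by split=> h y yx; have := h y yx; rewrite !drawing_label.
- exact: drawing_source_vertex.
- move=> i j E; apply: face_inj; have [e Ei [le hm]] := face_corner i.
  rewrite Ei; have [e' Ej [le' hm']] := face_corner j; rewrite Ej.
  have := orbit_set_refl (m := q) sigma (e, false).
  rewrite -/(origin _) -(drawing_source Ei le hm) E => /imsetP[e1].
  rewrite inE Ej => /andP[e1j _] [e1e]; rewrite -e1e in e1j.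
  by rewrite (orbit_set_mem P_inj e1j).
- by move=> i x /drawing_source_lab E; rewrite drawing_label E.
Qed.

Local Notation dn := (@down_half k (drawing u)).

Lemma down_drawing x : is_down (@alpha q) (@corner_label k (drawing u)) x = x.2.
Proof.
by rewrite /is_down !drawing_label; case: x => e []; rewrite /draw_label /=; lia.
Qed.

Definition undraw (c : new_map (drawing u)) : m := (dn c).1.

Lemma down_half_undraw c : dn c = (undraw c, true).
Proof.
have := down_half_down drawing_labelled c; rewrite down_drawing /undraw.
by case: (dn c) => e b /= ->.
Qed.

(** The decreasing half-edges of the drawing are the [(e, true)], one per half-edge of [u];
    [draw_first_return] and [draw_phi_A] then match rotation and reversal through the uniqueness
    lemmas. *)
Lemma undraw_iso : @iso_unrootedLM k (Psi_unrooted (drawing u)) u undraw.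
Proof.
have G := drawing_labelled.
have ub : bijective undraw.
  apply: inj_card_bij.
    move=> c z E; apply: (down_half_inj G).
    by rewrite !down_half_undraw E.
  have c1 := card_edges (new_alpha_inv G) (new_alpha_neq G).
  have [_ _ e1] := psi_counts G.
  have c2 : (#|edges q| * 2 = #|q|)%N.
    apply: card_edges; first exact: drawing_alpha_inv.
    by move=> [e []]; rewrite xpair_eqE andbF.
  have c3 : (#|q| = #|m| * 2)%N by rewrite card_prod card_bool.
  have c4 : (#|new_map (drawing u)| * 2 = #|m| * 2)%N by rewrite -c3 -c2 e1 c1.
  by rewrite -(leq_pmul2r (ltn0Sn 1)) c4.
have ui : @map_iso (new_map (drawing u)) m undraw.
  split=> // c.
    have [n /andP[n0 /eqP En] hn] := draw_first_return P_inj A_inv SP l_S l_A (undraw c).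
    have [z uz] : exists z, dn z = (sigma (undraw c), true).
      by apply: (down_half_surj G); rewrite down_drawing.
    rewrite (@new_sigma_unique k (drawing u) G c z n) //.
    - by rewrite /undraw uz.
    - by rewrite down_half_undraw uz -En.
    - by move=> i /hn; rewrite down_drawing down_half_undraw => ->.
  have [z uz] : exists z, dn z = (alpha (undraw c), true).
    by apply: (down_half_surj G); rewrite down_drawing.
  rewrite (@new_alpha_unique k (drawing u) G c z); first by rewrite /undraw uz.
  rewrite /up uz down_half_undraw !drawing_phi.
  exact: (draw_phi_A P_inj A_inv SP l_S l_A).
split=> //; last first.
  exists 0 => c; rewrite addr0 /= (cl_val G) down_half_undraw drawing_label.
  by [].
move=> i; have [e Ei [le hm]] := face_corner i.
have [z uz] : exists z, dn z = (e, true).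
  by apply: (down_half_surj G); rewrite down_drawing.
have Ez : origin (up (@alpha _) dn z) = qsource (drawing u) i.
  by rewrite (drawing_source Ei le hm) /up uz.
have hphi := iso_phi ui (new_sigma_inj G) s_inj (new_alpha_inv G) A_inv.
have := iso_orbit hphi z.
by rewrite -(new_face_orbit G Ez) {2}/undraw uz -Ei.
Qed.

(** Euler's relation passes from [u] to the isomorphic new map of the drawing, and from there to the
    drawing by [psi_counts]. *)
Lemma drawing_in_Q : in_Q g (drawing u).
Proof.
have G := drawing_labelled; apply: labelled_in_Q => //.
have [v1 v2 v3] := psi_counts G.
have ui : @map_iso (new_map (drawing u)) m undraw by have [] := undraw_iso.
have [w1 w2 w3] := iso_euler ui (new_sigma_inj G) s_inj (new_alpha_inv G) A_inv.
have [[_ _ m0 _ E] _ _ _ _] := H.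
split.
- exact: drawing_sigma_inj.
- by split; [exact: drawing_alpha_inv | move=> [e []]; rewrite xpair_eqE andbF].
- by rewrite card_prod card_bool muln_gt0 m0.
- exact: drawing_connect.
- by move: E; rewrite w1 w2 w3 v1 v2 v3; lia.
Qed.

End Drawing.

Section DrawingNatural.
Variables (g k : nat) (u u' : unrootedLM k) (h : lmap u -> lmap u').
Hypotheses (H : in_LM g u) (H' : in_LM g u') (iso_h : iso_unrootedLM h).

Lemma iso_source_label c : (forall e, llabel (h e) = llabel e + c) ->
  forall i, source_label u' i = source_label u i + c.
Proof.
move=> hc i; have [_ hf _] := iso_h.
have [e Ei [le hmin]] := face_corner H i.
have -> : source_label u i = llabel e - 1 by rewrite le addrK.
rewrite addrAC -hc {1}/source_label; congr (_ - 1); apply: min_int_eq.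
  by apply: map_f; rewrite mem_enum -hf imset_f // Ei orbit_set_refl.
move=> y /mapP[e']; rewrite mem_enum -hf => /imsetP[e1 e1i ->] ->; rewrite !hc lerD2r.
by move: e1i; rewrite Ei mem_orbit_set => /iter_findex <-.
Qed.

Lemma drawing_natural : @iso_unrootedQ k (drawing u) (drawing u') (fun x => (h x.1, x.2)).
Proof.
have [hi hf [c hc]] := iso_h; have [hb hs ha] := hi; have hinj := bij_inj hb.
have [[si [ai _] _ _ _] _ _ _ _] := H; have [[si' [ai' _] _ _ _] _ _ _ _] := H'.
have sl := iso_source_label hc.
split.
- split.
  + have [h' hK Kh] := hb; exists (fun x => (h' x.1, x.2)) => -[e b] /=; by rewrite ?hK ?Kh.
  + move=> [e b]; apply/esym.
    exact: (draw_sigma_iso _ _ (phi_inj si ai) (phi_inj si' ai') hb hs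
      (iso_phi hi si si' ai ai') hc).
  + by [].
- move=> i; apply/setP => -[e b]; apply/imsetP/imsetP.
    case=> _ /imsetP[e1 + ->] [-> ->]; rewrite !inE => /andP[e1i /eqP l1].
    by exists (h e1); rewrite // inE -hf imset_f //= hc l1 sl addrAC.
  case=> e1; rewrite !inE -hf => /andP[/imsetP[e2 e2i ->]].
  rewrite hc sl addrAC (inj_eq (addIr c)) => /eqP l2 [-> ->].
  by exists (e2, false) => //; apply: imset_f; rewrite inE e2i l2 /=.
- by exists c => i; apply: sl.
Qed.

End DrawingNatural.

Section Reconstruction.
Variables (k : nat) (t : unrootedQ k).
Hypothesis G : labelled_quadrangulation t.
Local Notation M := (new_map t).
Local Notation dn := (@down_half k t).

Lemma redraw_iso : @iso_unrootedQ k (drawing (Psi_unrooted t)) t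
  (drawn_edge (@alpha (qmap t)) dn).
Proof.
have p4 x := (lq_phi4 G x).1.
have L_s : forall x : qmap t, corner_label (sigma x) = corner_label x := @cl_sigma k t G.
have A_inv := new_alpha_inv G; have SP := new_SP G.
have P_inj := phi_inj (new_sigma_inj G) A_inv.
have sE x : sigma (drawn_edge alpha dn x) = drawn_edge alpha dn
    (draw_sigma (@sigma M) (@phi M) (fun c => corner_label (val c)) x).
  rewrite (drawn_edge_sigma (lq_sigma G) (lq_alpha G) (lq_sp G) p4 L_s (lq_label G)
    (@down_half_inj k t G) (down_half_down G) (@down_half_surj k t G) (down_half_S G)
    (up_half_A G) A_inv SP).
  apply: congr1; case: x => c b.
  have idb : bijective (@id M) by exists id.
  have hl (z : M) : corner_label (dn z) = corner_label (val z) + 0 by rewrite addr0 cl_val.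
  (* [drawn_edge_sigma] uses the label at [dn c] and [drawing] the one at [val c]; transport along
     the identity with constant 0 exchanges them. *)
  rewrite [LHS](@draw_sigma_iso _ _ id (@sigma M) (@sigma M) (@phi M) (@phi M)
    (fun z : M => corner_label (val z)) _ 0 c b P_inj P_inj idb _ _ hl) //.
  by case: (draw_sigma _ _ _ _).
split.
- split.
  + exact: (drawn_edge_bij (lq_alpha G) (lq_label G) (@down_half_inj k t G)
      (down_half_down G) (@down_half_surj k t G)).
  + by move=> x; rewrite sE.
  + by move=> [c b]; rewrite (drawn_edge_alpha _ (lq_alpha G)).
- move=> i; have [c0 E0] := source_corner G i.
  have a0 : around_source sigma alpha (@corner_label k t) (up alpha dn c0).
    by apply/(around_sourceP G); exists i.
  have orb := new_face_orbit G E0; have sl := source_labelE G E0.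
  apply/setP => y; apply/imsetP/idP.
    case=> _ /imsetP[c + ->] ->; rewrite inE => /andP[ci /eqP lc].
    have {}ci : c \in new_face t i := ci.
    rewrite orb mem_orbit_set in ci; rewrite sl subrK /= (cl_val G) in lc.
    have [_] := source_face_min (lq_sigma G) (lq_alpha G) (lq_sp G) p4 L_s (lq_label G)
      (@down_half_inj k t G) (down_half_down G) (@down_half_surj k t G) (down_half_S G)
      (up_half_A G) SP (findex (@phi M) c0 c) a0.
    by rewrite iter_findex // => /(_ lc); rewrite -E0 mem_orbit_set.
  rewrite -E0 => yi; have oy := origin_mem (lq_sigma G) yi.
  have /(around_sourceP G)/(_ 0%N) /= ay : exists i, origin y = qsource t i.
    by exists i; rewrite oy.
  have [c uc] := up_surj (lq_alpha G) (lq_label G) (@down_half_surj k t G) ay.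
  exists (c, false); last by rewrite /drawn_edge /= uc.
  apply: imset_f; rewrite inE; apply/andP; split.
    suff : c \in new_face t i by [].
    have Ec : origin (up (@alpha (qmap t)) dn c) = qsource t i.
      by move: oy; rewrite E0 -uc.
    by rewrite (new_face_orbit G Ec) orbit_set_refl.
  rewrite sl subrK /= (cl_val G); apply/eqP; apply: (lm_eq_up (down_half_down G)); rewrite uc.
  exact: cl_origin oy.
- exists 0 => i; rewrite addr0 /=; have [c0 E0] := source_corner G i.
  rewrite (source_labelE G E0) -(lq_delay G E0).
  by rewrite (L_up (down_half_down G)).
Qed.

Lemma Psi_in_LM g : map_of_genus (qmap t) g -> in_LM g (Psi_unrooted t).
Proof.
move=> [si [ai an] q0 conn E].
have p4 x := (lq_phi4 G x).1.
have L_s : forall x : qmap t, corner_label (sigma x) = corner_label x := @cl_sigma k t G.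
have A_inv := new_alpha_inv G; have SP := new_SP G.
have [v1 v2 v3] := psi_counts G.
split.
- split.
  + exact: new_sigma_inj.
  + by split; [exact: new_alpha_inv | exact: new_alpha_neq].
  + have c1 := card_edges ai an; have c2 := card_edges A_inv (new_alpha_neq G).
    have {}q0 : (0 < #|qmap t|)%N by [].
    rewrite -c1 v3 c2 in q0; by move: q0; rewrite muln_gt0 andbT.
  + exact: (derived_connect (lq_sigma G) (lq_alpha G) (lq_sp G) p4 L_s (lq_label G)
      (@down_half_inj k t G) (down_half_down G) (@down_half_surj k t G) (down_half_S G)
      (up_half_A G) A_inv SP conn).
  + have {}E : (#|vertices (qmap t)| + #|faces (qmap t)| + g.*2 = #|edges (qmap t)| + 2)%N := E.
    rewrite v1 v2 v3 in E.
    suff : (#|vertices M| + #|faces M| + g.*2 = #|edges M| + 2)%N by [].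
    by lia.
- exact: (new_face_inj G).
- exact: (new_faces G).
- move=> c; have := lm_S L_s (down_half_S G) c.
  by rewrite /= !(cl_val G).
- move=> c; have := lm_A (lq_alpha G) (lq_sp G) p4 L_s (lq_label G) (down_half_down G)
    (up_half_A G) c.
  by rewrite /= !(cl_val G).
Qed.

End Reconstruction.

(** * Roots and the two preimages *)

Lemma Psi_root k (t : rootedQ k) : labelled_quadrangulation t ->
  exists2 e : new_map t, Psi t = Some (@RootedLM k (Psi_unrooted t) e)
    & down_half e = qroot t \/ down_half e = alpha (qroot t).
Proof.
move=> G; rewrite /Psi; case: pickP => [e|h].
  rewrite !(drawnE G) => e_root; exists e => //.
  by case/orP: e_root => /eqP; [left | right].
have [e He] : exists e, down_half e = qroot t \/ down_half e = alpha (qroot t).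
  have dE := is_down_a (lq_alpha G) (lq_label G) (qroot t).
  case: (boolP (is_down alpha (@corner_label k t) (qroot t))) => d.
    by have [e] := down_half_surj G d; exists e; left.
  by rewrite -dE in d; have [e] := down_half_surj G d; exists e; right.
by have := h e; rewrite !(drawnE G); case: He => ->; rewrite eqxx ?orbT.
Qed.

(** An edge has only one decreasing orientation, so the corner picked as the root depends on the
    root edge alone. *)
Lemma down_half_edge k (t : unrootedQ k) (e e' : new_map t) x :
  labelled_quadrangulation t ->
  down_half e = x \/ down_half e = alpha x -> down_half e' = x \/ down_half e' = alpha x ->
  e = e'.
Proof.
move=> G; have dE := is_down_a (lq_alpha G) (lq_label G) x.
have := down_half_down G e; have := down_half_down G e'.
move=> d' d He He'; apply: (down_half_inj G).
case: He He' => E [] E'; rewrite E E' // in d d' *.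
  by rewrite dE d in d'.
by rewrite dE d' in d.
Qed.

Lemma isoLM_comp k (u1 u2 u3 : rootedLM k) : isoLM u1 u2 -> isoLM u2 u3 -> isoLM u1 u3.
Proof.
move=> [f fi fr] [f' fi' fr']; exists (f' \o f); first exact: iso_unrootedLM_comp fi fi'.
by rewrite /= fr.
Qed.

Lemma Psi_isoLM k g (t t' : rootedQ k) (u u' : rootedLM k) : (0 < k)%N ->
  in_Q g t -> in_Q g t' -> isoQ t t' -> Psi t = Some u -> Psi t' = Some u' -> isoLM u u'.
Proof.
move=> k0 Q Q' [h hi hr]; have G := in_Q_labelled k0 Q; have G' := in_Q_labelled k0 Q'.
have conn' : forall e e' : qmap t',
    connect (fun a b => (sigma a == b) || (alpha a == b)) e e' by case: Q' => [[[]]].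
have [e -> He] := Psi_root G; have [e' -> He'] := Psi_root G' => -[<-] [<-].
have [hm him hdn] := Psi_natural hi G G' conn'.
exists hm => //=; apply: (down_half_edge G' _ He'); rewrite hdn -hr.
have [[_ _ ha] _ _] := hi.
by case: He => ->; [left | right; rewrite ha].
Qed.

(** [t] is isomorphic to the drawing of its image, hence to the drawing of [u]. Following the root
    leaves only its orientation [b] undetermined. *)
Lemma isoQ_of_isoLM k g (t : rootedQ k) (u u' : rootedLM k) :
  labelled_quadrangulation t -> map_of_genus (qmap t) g -> in_LM g u ->
  Psi t = Some u' -> isoLM u' u ->
  exists b, isoQ t (@RootedQ k (drawing u) (lroot u, b)).
Proof.
move=> G mg Hu; have [e -> He] := Psi_root G => -[<-] [h hi /= hr].
have K := drawing_natural (Psi_in_LM G mg) Hu hi.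
have [E' [EK _ Ei]] := iso_unrootedQ_inv (redraw_iso G).
have comp := iso_unrootedQ_comp Ei K.
have [b Eb] : exists b, qroot t = drawn_edge (@alpha (qmap t)) (@down_half k t) (e, b).
  case: He => E; first by exists true; rewrite /drawn_edge /= E.
  by exists false; rewrite /drawn_edge /up /= E (lq_alpha G).
exists b; exists (fun x => (h (E' x).1, (E' x).2)) => //=.
by rewrite Eb EK /= hr.
Qed.

Theorem corollary1 (k g : nat) (hk : (1 <= k)%N) :
  (* Psi is a mapping from (classes in) Q_{g,k} to (classes in) LM_{g,k} *)
  [/\ forall t : rootedQ k, in_Q g t ->
        exists2 u : rootedLM k, Psi t = Some u & in_LM g u,
      forall (t t' : rootedQ k) (u u' : rootedLM k),
        in_Q g t -> in_Q g t' -> isoQ t t' ->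
        Psi t = Some u -> Psi t' = Some u' -> isoLM u u'
  (* every class in LM_{g,k} has exactly two preimages *)
    & forall u : rootedLM k, in_LM g u ->
        exists t1 t2 : rootedQ k,
          [/\ in_Q g t1, in_Q g t2, ~ isoQ t1 t2 &
              forall t : rootedQ k, in_Q g t ->
                ((exists2 u' : rootedLM k, Psi t = Some u' & isoLM u' u)
                 <-> (isoQ t t1 \/ isoQ t t2))]].
Proof.
split=> [t Q|t t' u u'|u Hu].
- have G := in_Q_labelled hk Q; have [e -> _] := Psi_root G.
  exists (@RootedLM k (Psi_unrooted t) e) => //=; apply: (Psi_in_LM G).
  by case: Q => [[]].
- exact: Psi_isoLM.
pose tb b := @RootedQ k (drawing u) (lroot u, b).
have G0 := drawing_labelled Hu; have Q0 := drawing_in_Q Hu.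
exists (tb true), (tb false); split=> //.
  move=> [h hi /= hr].
  have conn : forall e e' : qmap (drawing u),
      connect (fun a b => (sigma a == b) || (alpha a == b)) e e' by case: Q0 => [[[]]].
  have := iso_is_down hi G0 G0 conn (lroot u, true).
  by rewrite hr !(down_drawing Hu).
move=> t Q; have G := in_Q_labelled hk Q.
have mg : map_of_genus (qmap t) g by case: Q => [[]].
split=> [[u' Eu' iu']|].
  by have [[] it] := isoQ_of_isoLM G mg Hu Eu' iu'; [left | right].
have back b : isoQ t (tb b) -> exists2 u' : rootedLM k, Psi t = Some u' & isoLM u' u.
  move=> it; have [e Et _] := Psi_root G.
  have [e0 E0 He0] := Psi_root (t := tb b) G0.
  exists (@RootedLM k (Psi_unrooted t) e) => //.
  have iso0 := Psi_isoLM hk Q (Q0 : in_Q g (tb b)) it Et E0.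
  apply: (isoLM_comp iso0).
  exists (@undraw k u) => /=; first exact: undraw_iso Hu.
  by rewrite /undraw; case: He0 => ->.
by case; apply: back.
Qed.
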